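(* Assume the following. (i) For all $t\in\Theta$, $\varphi_t$ is invertible and increasing from $I_1$ to $I_2$, where $I_1,I_2$ are subsets of $\mathbb{R}$. (ii) For all $x\in I_2$, the map $t\mapsto\varphi_t^{-1}(x)$ is continuously differentiable on $\Theta$, with derivative denoted $\partial\varphi_t^{-1}(x)$. (iii) For all $t\in\Theta$, $\mathbb{E}\big[|\varphi_t^{-1}(\varphi_\theta(\varepsilon))|^2\big]<+\infty$. (iv) For every compact $B\subset\Theta$, $\mathbb{E}\big[\sup_{t\in B}|\partial\varphi_t^{-1}(\varphi_\theta(\varepsilon))|^4\big]<+\infty$. (v) $a<b$ are such that $[a,b]\subset\Theta$, $\theta\in\,]a,b[$, and $(t-\theta)M'(t)>0$ for all $t\in[a,b]$ with $t\neq\theta$. (vi) For all $x\in I_2$, $t\mapsto\varphi_t^{-1}(x)$ is twice differentiable on $\Theta$, with second derivative denoted $\partial^2\varphi_t^{-1}(x)$, and for every compact $B\subset\Theta$, $\mathbb{E}\big[\sup_{t\in B}|\partial^2\varphi_t^{-1}(\varphi_\theta(\varepsilon))|^2\big]<+\infty$. (vii) $M''(\theta)>1/2$. (viii) There exists $\alpha>4$ such that for every compact $B\subset\Theta$, $\mathbb{E}\big[\sup_{t\in B}|\partial\varphi_t^{-1}(\varphi_\theta(\varepsilon))|^{\alpha}\big]<+\infty$. Let $(\widehat\theta_n)_{n\ge0}$ be the projected Robbins-Monro sequence defined in the context, with steps $\gamma_n=1/n$. Then, as $n\to\infty$, $$\sqrt{n}\,(\widehat\theta_n-\theta)\longrightarrow\delta_0\quad\text{in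 distribution},$$ where $\delta_0$ is the Dirac mass at $0$. Moreover, if in addition $M''(t)\ge1/2$ for all $t\in[a,b]$, then for all $n\ge0$, $$\mathbb{E}\big[(\widehat\theta_n-\theta)^2\big]\le(\widehat\theta_0-\theta)^2\,\frac{\exp(C_1\pi^2/6)}{n+1},\qquad\text{where } C_1=4\,\mathbb{E}\Big[\sup_{t\in[a,b]}|\partial\varphi_t^{-1}(\varphi_\theta(\varepsilon))|^4\Big].$$
   Context: $\Theta\subset\mathbb{R}$ is an interval, $\theta\in\Theta$ is an (unknown) parameter, and $(\varphi_t)_{t\in\Theta}$ is a (known) family of real functions. $(\varepsilon_n)_{n\ge0}$ is a sequence of independent identically distributed real random variables with values in $I_1$, and $X_n=\varphi_\theta(\varepsilon_n)$ for all $n\ge0$. $\varepsilon$ and $X$ denote random variables with the same distribution as $\varepsilon_n$ and $X_n$, with $X=\varphi_\theta(\varepsilon)$. The function $M$ is defined on $\Theta$ by $$M(t)=\mathbb{E}\big[|\varphi_t^{-1}(\varphi_\theta(\varepsilon))-\varepsilon|^2\big],$$ and its first and second derivatives are given by $$M'(t)=-2\,\mathbb{E}\big[\partial\varphi_t^{-1}(X)(\varepsilon-\varphi_t^{-1}(X))\big],\quad M''(t)=2\,\mathbb{E}\big[(\partial\varphi_t^{-1}(X))^2\big]-2\,\mathbb{E}\big[\partial^2\varphi_t^{-1}(X)(\varepsilon-\varphi_t^{-1}(X))\big].$$ Let $\pi_{[a;b]}$ be the projection of $\mathbb{R}$ onto $[a,b]$: $\pi_{[a;b]}(x)=x$ if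 $a\le x\le b$, $=a$ if $x\le a$, $=b$ if $x\ge b$. The projected Robbins-Monro sequence with steps $(\gamma_n)_{n\ge1}$ is defined by a deterministic initial value $\widehat\theta_0\in[a,b]$ and, for $n\ge0$, $$\widehat\theta_{n+1}=\pi_{[a;b]}\big(\widehat\theta_n-\gamma_{n+1}T_{n+1}\big),\qquad T_{n+1}=-2\,\partial\varphi_{\widehat\theta_n}^{-1}(X_{n+1})\big(\varepsilon_{n+1}-\varphi_{\widehat\theta_n}^{-1}(X_{n+1})\big).$$ *)

(* Defs.v *)
From HB Require Import structures.
From mathcomp Require Export all_boot all_order all_algebra.
From mathcomp Require Export all_classical all_reals all_analysis.
Export Order.TTheory GRing.Theory Num.Theory.
Export numFieldNormedType.Exports.

Set Implicit Arguments.
Unset Strict Implicit.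
Unset Printing Implicit Defensive.

Local Open Scope classical_set_scope.
Local Open Scope ring_scope.

(* Differentiation relative to a set [A]: only increments staying inside [A]
   are used, so the derivative is one-sided at an endpoint of an interval that
   contains it.  [derive_on A f t] is meaningful only when
   [derivable_on A f t] holds. *)
Definition diff_quot {R : realType} (f : R -> R) (t : R) : R -> R :=
  fun s => (f s - f t) / (s - t).

Definition derivable_on {R : realType} (A : set R) (f : R -> R) (t : R) :=
  cvg (diff_quot f t @ within A t^').

Definition derive_on {R : realType} (A : set R) (f : R -> R) (t : R) : R :=
  lim (diff_quot f t @ within A t^').

Definition continuously_differentiable_on {R : realType} (A : set R)
    (f : R -> R) :=
  (forall t, A t -> derivable_on A f t) /\
  {within A, continuous (derive_on A f)}.

Definition twice_differentiable_on {R : realType} (A : set R) (f : R -> R) :=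
  forall t, A t -> derivable_on A f t /\ derivable_on A (derive_on A f) t.

(* The product rule is required for every finite subfamily. *)
Definition independent_seq {d : measure_display} {T : measurableType d}
    {R : realType} (P : probability T R) (Y : nat -> {RV P >-> R}) :=
  forall (s : seq nat) (B : nat -> set R), uniq s ->
    (forall i, measurable (B i)) ->
    P (\bigcap_(i in [set` s]) (Y i @^-1` B i)) =
    (\prod_(i <- s) P (Y i @^-1` B i))%E.

Definition same_law {d : measure_display} {T : measurableType d}
    {R : realType} (P : probability T R) (Y Z : {RV P >-> R}) :=
  forall B : set R, measurable B -> P (Y @^-1` B) = P (Z @^-1` B).

(* Convergence in distribution, tested against bounded continuous functions.
   Measurability of each [Y n] is part of the notion, since the [Y n] are not
   bundled as random variables. *)
Definition cvg_in_distribution {d : measure_display} {T : measurableType d}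
    {R : realType} (P : probability T R) (Y : nat -> T -> R)
    (mu : {measure set R -> \bar R}) :=
  (forall n, measurable_fun setT (Y n)) /\
  (forall f : R -> R, continuous f -> (exists C, forall x, `|f x| <= C) ->
    'E_P[f \o Y n]%E @[n --> \oo] --> (\int[mu]_x (f x)%:E)%E).

(* E[sup_{t in B} g_t], computed in the extended reals so that an unbounded
   supremum counts as +oo. *)
Definition expect_sup {d : measure_display} {T : measurableType d}
    {R : realType} (P : probability T R) (B : set R) (g : R -> T -> R) :
    \bar R :=
  (\int[P]_w ereal_sup [set (g t w)%:E | t in B])%E.

(* The inverse of [phi t] seen as a bijection from [I1]; the value outside
   [phi t @` I1] is irrelevant. *)
Definition phi_inv {R : realType} (I1 : set R) (phi : R -> R -> R)
    (t x : R) : R :=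
  'pinv_(fun=> 0) I1 (phi t) x.

Definition dphi_inv {R : realType} (Theta I1 : set R) (phi : R -> R -> R)
    (t x : R) : R :=
  derive_on Theta (fun s => phi_inv I1 phi s x) t.

Definition d2phi_inv {R : realType} (Theta I1 : set R) (phi : R -> R -> R)
    (t x : R) : R :=
  derive_on Theta (fun s => dphi_inv Theta I1 phi s x) t.

Definition contrast {d : measure_display} {T : measurableType d}
    {R : realType} (P : probability T R) (I1 : set R) (phi : R -> R -> R)
    (theta : R) (e : T -> R) (t : R) : R :=
  fine ('E_P[fun w => (`|phi_inv I1 phi t (phi theta (e w)) - e w| ^+ 2)%R])%E.

Definition clip {R : realType} (a b x : R) : R :=
  if x <= a then a else if b <= x then b else x.

Fixpoint robbins_monro {R : realType} {T : Type} (Theta I1 : set R)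
    (phi : R -> R -> R) (a b : R) (gamma : nat -> R)
    (eps X : nat -> T -> R) (theta0 : R) (n : nat) (w : T) : R :=
  if n is m.+1 then
    let th := robbins_monro Theta I1 phi a b gamma eps X theta0 m w in
    let T_n := - 2 * dphi_inv Theta I1 phi th (X m.+1 w)
                 * (eps m.+1 w - phi_inv I1 phi th (X m.+1 w)) in
    clip a b (th - gamma m.+1 * T_n)
  else theta0.

(* Main.v *)
Require Import Defs.
From mathcomp Require Import ring lra measurable_realfun.

(** Write [V n = (theta_hat n - theta) ^ 2] and [g = 1 / (n + 1)].  At
    [t = theta] the residual [phi_t^-1 X - eps] vanishes, so the noise of the
    algorithm is multiplicative: by the mean value theorem the second moment of
    the increment direction is at most [C1 * (t - theta) ^ 2].  Since the
    projection is a contraction, conditioning on the past gives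
    [E V (n + 1) <= (1 - 2 c g + C1 g ^ 2) E V n] wherever
    [(t - theta) M'(t) >= c (t - theta) ^ 2], and this also holds on restriction
    to an event of the past.
    - If [M'' >= 1/2] on [[a, b]], then [c = 1/2] everywhere, and multiplying
      the factors gives the rate [1 / n].
    - In general compactness gives some [c0 > 0] on [[a, b]], so that [E V n]
      tends to [0], while [M''(theta) > 1/2] gives some [c > 1/2] close to
      [theta].  Let [A n] be the event that [V k <= del] for all [N <= k <= n].
      Then [E (V n; A n) + del * P (~ A n)] is nonincreasing, so [P (~ A n)] is
      at most [E V N / del], uniformly in [n], and [n * E (V n; A n)] tends
      to [0] because [2 c > 1].  Hence [n * V n] tends to [0] in probability. *)

Set Implicit Arguments.
Unset Strict Implicit.
Unset Printing Implicit Defensive.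

Local Open Scope classical_set_scope.
Local Open Scope ring_scope.

(** * Recursions with harmonic steps *)

Section numeric.
Context {R : realType}.
Implicit Types (u : nat -> R) (c C : R).

Lemma sin_le_id (x : R) : 0 <= x -> sin x <= x.
Proof.
move=> x0.
have [|c _] := @MVT_segment R (@sin R) (@cos R) 0 x x0.
  by apply: continuous_subspaceT => y; exact: continuous_sin.
rewrite sin0 !subr0 => ->.
by rewrite ler_piMl// cos_le1.
Qed.

(* [s = sin (pi / 6)] solves [3 s - 4 s ^ 3 = 1], i.e.
   [(s + 1) (2 s - 1) ^ 2 = 0]. *)
Lemma pi_ge3 : 3 <= pi :> R.
Proof.
set s := sin (pi / 6 : R).
have pi0 : 0 < pi :> R := pi_gt0 R.
have s0 : 0 < s by apply: sin_gt0_pi; apply/andP; split; lra.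
have : 3 * s - 4 * s ^+ 3 = 1.
  transitivity (sin (pi / 2 : R)); last exact: sin_pihalf.
  have -> : pi / 2 = pi / 6 + (pi / 6 + pi / 6) :> R by lra.
  rewrite sinD sinD cosD -/s.
  have := cos2sin2 (pi / 6 : R); rewrite -/s.
  move: (cos _) => k; move: (s) => z e.
  transitivity (3 * z * k ^+ 2 - z ^+ 3); last by ring.
  by rewrite e; ring.
move=> h.
have {h} : (s + 1) * (2 * s - 1) ^+ 2 = 0.
  have -> : (s + 1) * (2 * s - 1) ^+ 2 = 1 - (3 * s - 4 * s ^+ 3) by ring.
  by rewrite h subrr.
move=> /eqP; rewrite mulf_eq0 gt_eqF ?addr_gt0//= sqrf_eq0 subr_eq0 => /eqP s2.
have : s <= pi / 6 by apply: sin_le_id; lra.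
lra.
Qed.

Lemma ln_succ_le (n : nat) : ln (n.+2%:R : R) - ln (n.+1%:R) <= n.+1%:R^-1.
Proof.
rewrite -ln_div ?posrE ?ltr0Sn//.
have -> : n.+2%:R / n.+1%:R = 1 + n.+1%:R^-1 :> R.
  by rewrite -(natr1 n.+1) mulrDl divff ?pnatr_eq0// mul1r.
by rewrite le_ln1Dx// (lt_le_trans _ (_ : 0 <= _))// ?ltrN10 ?invr_ge0.
Qed.

(** Each factor [1 - x] is at most [expR (- x)], whatever its sign, and [1 / (n + 1)] dominates the
    increment of [ln], so the product of the factors telescopes below [((N + 1) / (n + 1)) ^ c]. *)
Lemma harmonic_rec_bound u c (N : nat) : 0 <= c -> (forall n, 0 <= u n) ->
  (forall n, (N <= n)%N -> u n.+1 <= (1 - c / n.+1%:R) * u n) ->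
  forall n, (N <= n)%N ->
    u n <= u N * expR (c * (ln N.+1%:R - ln n.+1%:R)).
Proof.
move=> c0 u0 uS; elim=> [|n IH].
  by rewrite leqn0 => /eqP ->; rewrite subrr mulr0 expR0 mulr1.
rewrite leq_eqVlt => /predU1P[<-|]; first by rewrite subrr mulr0 expR0 mulr1.
rewrite ltnS => Nn.
apply: (le_trans (uS _ Nn)).
apply: (@le_trans _ _ (expR (- (c / n.+1%:R)) * u n)).
  by rewrite ler_wpM2r// expR_ge1Dx.
apply: (@le_trans _ _ (expR (c * (ln n.+1%:R - ln n.+2%:R)) *
    (u N * expR (c * (ln N.+1%:R - ln n.+1%:R))))).
  apply: ler_pM; rewrite ?expR_ge0 ?IH//.
  rewrite ler_expR -mulrN ler_wpM2l//.
  by rewrite lerNl opprB ln_succ_le.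
by rewrite mulrCA -expRD -mulrDr addrC subrKA.
Qed.

Lemma cvg_ln_nat : ln (n.+1%:R : R) @[n --> \oo] --> +oo.
Proof.
apply/cvgryPge => A; near=> n.
rewrite -[A]expRK ler_ln ?posrE ?expR_gt0 ?ltr0Sn//.
apply: (@le_trans _ _ n%:R); last by rewrite ler_nat.
by near: n; exact: nbhs_infty_ger.
Unshelve. all: by end_near. Qed.

Lemma harmonic_rec_cvg u c (N : nat) : 0 < c -> (forall n, 0 <= u n) ->
  (forall n, (N <= n)%N -> u n.+1 <= (1 - c / n.+1%:R) * u n) ->
  u n @[n --> \oo] --> 0.
Proof.
move=> c0 u0 uS.
have bd := harmonic_rec_bound (ltW c0) u0 uS.
apply: (@squeeze_cvgr _ _ _ _ (fun=> 0)
  (fun n => u N * expR (c * (ln N.+1%:R - ln n.+1%:R)))); last 2 first.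
- exact: cvg_cst.
- rewrite -[X in _ --> X](mulr0 (u N)); apply: cvgMr.
  rewrite [X in X @ _ --> _](_ : _ = (fun x => expR (- x)) \o
      (fun n => c * (ln n.+1%:R - ln N.+1%:R))); last first.
    by apply/funext => n /=; rewrite -mulrN opprB.
  apply: cvg_comp; last exact: cvgr_expR.
  apply/cvgryPge => A; near=> n.
  rewrite -ler_pdivrMl// lerBrDr.
  near: n; move/cvgryPge: cvg_ln_nat; exact.
- near=> n; rewrite u0/= bd//; near: n; exact: nbhs_infty_ge.
Unshelve. all: by end_near. Qed.

(** Passing from [u n] to [n * u n] costs one unit in the constant: with [k = n + 1], the number
    [k * (1 - c / k) = k - c] is below [(1 - (c - 1) / k) * (k - 1)] by exactly [(c - 1) / k]. *)
Lemma harmonic_rec_cvg_lin u c (N : nat) : 1 < c -> (forall n, 0 <= u n) ->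
  (forall n, (N <= n)%N -> u n.+1 <= (1 - c / n.+1%:R) * u n) ->
  n%:R * u n @[n --> \oo] --> 0.
Proof.
move=> c1 u0 uS.
apply: (@harmonic_rec_cvg _ (c - 1) N).
- by rewrite subr_gt0.
- by move=> n; rewrite mulr_ge0.
move=> n Nn.
have k0 : 0 < n.+1%:R :> R by rewrite ltr0Sn.
apply: (@le_trans _ _ (n.+1%:R * ((1 - c / n.+1%:R) * u n))).
  by rewrite ler_wpM2l ?ler0n// uS.
rewrite !mulrA ler_wpM2r//.
have -> : n%:R = n.+1%:R - 1 :> R by rewrite -natr1 addrK.
have -> : n.+1%:R * (1 - c / n.+1%:R) = n.+1%:R - c :> R.
  by rewrite mulrBr mulr1 mulrCA divff ?gt_eqF// mulr1.
have -> : (1 - (c - 1) / n.+1%:R) * (n.+1%:R - 1) =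
  n.+1%:R - c + (c - 1) / n.+1%:R :> R by field; rewrite gt_eqF.
by rewrite lerDl divr_ge0 ?subr_ge0 ?ltW.
Qed.

(** The maximum of [C * expR (- 3/4 * C)] is [4 / (3 * expR 1)], which is at most [1/2] exactly when
    [expR 1 >= 8/3]. The power [64 = 2 ^ 6] already suffices and is reached by six squarings. *)
Lemma expR1_ge8div3 : 8/3 <= expR 1 :> R.
Proof.
have h : 1 + 1/64 <= expR (1/64) :> R by exact: expR_ge1Dx.
have -> : expR 1 = expR (1/64) ^+ 64 :> R.
  by rewrite -expRM_natl; congr expR; lra.
apply: (@le_trans _ _ ((1 + 1/64) ^+ 64)); last first.
  by rewrite lerXn2r ?nnegrE//; lra.
by rewrite -[64%N]/((2*2*2*2*2*2)%N) !exprM; lra.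
Qed.

(* The constant: the first factor is [C <= expR (3/4 * C) / 2], and
   [1 / k ^ 2 <= 1 / (k - 1/2) - 1 / (k + 1/2)] for [k >= 2] telescopes to
   [2/3], with [3/4 + 2/3 = 17/12 <= pi ^ 2 / 6]. *)
Lemma rate_one_rec_bound u C : 0 <= C -> (forall n, 0 <= u n) ->
  (forall n, u n.+1 <= (1 - n.+1%:R^-1 + C / n.+1%:R ^+ 2) * u n) ->
  forall n, u n <= u 0%N * (expR (C * pi ^+ 2 / 6) / n.+1%:R).
Proof.
move=> C0 u0 uS.
(* [s n] is [3/4] plus the telescoped bound on the sum of [1 / k ^ 2] for [2 <= k <= n]; thus
   [s 1 = 3/4] and [17/12] is the limit. *)
pose s n : R := 17/12 - 2 / (2 * n%:R + 1).
have bd n : u n.+1 <= u 0%N * (expR (C * s n.+1) / n.+2%:R).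
  elim: n => [|n IH].
    apply: le_trans (uS 0%N) _.
    rewrite mulrC ler_wpM2l// /s expr1n !divr1 invr1 subrr add0r.
    rewrite ler_pdivlMr//.
    have -> : C * (17 / 12 - 2 / (2 * 1 + 1)) = C * (3/4) by field.
    have := expR_ge1Dx (C * (3/4) - 1); rewrite expRD => h1.
    have e83 : expR (-1) <= (8/3)^-1 :> R.
      rewrite expRN lef_pV2 ?posrE ?expR_gt0 ?divr_gt0//.
      exact: expR1_ge8div3.
    have : C * (3/4) <= expR (C * (3/4)) * (8/3)^-1.
      apply: (@le_trans _ _ (expR (C * (3/4)) * expR (-1))); first lra.
      by rewrite ler_wpM2l ?expR_ge0.
    lra.
  apply: (le_trans (uS n.+1)).
  have [m mE] : exists m : R, m = n.+2%:R by exists n.+2%:R.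
  rewrite -mE in IH *.
  have m0 : 0 < m by rewrite mE ltr0Sn.
  have m1 : 2 <= m by rewrite mE (ler_nat _ 2).
  have -> : n.+3%:R = m + 1 :> R by rewrite mE natr1.
  apply: (@le_trans _ _ (expR (- m^-1 + C / m ^+ 2) *
      (u 0%N * (expR (C * s n.+1) / m)))).
    apply: ler_pM => //; last by rewrite -addrA expR_ge1Dx.
    have mi : m^-1 <= 1 by rewrite invf_le1//; lra.
    rewrite addr_ge0// ?subr_ge0//.
    by rewrite divr_ge0// exprn_ge0// ltW.
  rewrite mulrCA ler_wpM2l// ler_pdivlMr ?addr_gt0//.
  rewrite mulrA -expRD mulrAC -mulrA.
  (* Replacing [1 / m] by [1 / (m + 1)] costs the factor [(m + 1) / m]; its bound [expR (1 / m)]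
     cancels the [- 1 / m] of the contraction, and only [C / m ^ 2] is left in the exponent. *)
  have : (m + 1) / m <= expR m^-1.
    by rewrite mulrDl divff ?gt_eqF// mul1r expR_ge1Dx.
  move=> h; apply: le_trans (ler_wpM2l (expR_ge0 _) h) _.
  rewrite -expRD ler_expR.
  suff : C * (m ^- 2 + s n.+1) <= C * s n.+2 by lra.
  rewrite ler_wpM2l// /s -mE.
  have -> : n.+1%:R = m - 1 :> R by rewrite mE -(natr1 n.+1) addrK.
  have -> : 2 * (m - 1) + 1 = 2 * m - 1 :> R by lra.
  suff : m ^- 2 <= 2 / (2 * m - 1) - 2 / (2 * m + 1) by lra.
  have -> : 2 / (2 * m - 1) - 2 / (2 * m + 1) = (m ^+ 2 - 1/4)^-1.
    field; rewrite ?gt_eqF//; try lra; try nra.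
  rewrite lef_pV2 ?posrE; nra.
case=> [|n].
  rewrite divr1 ler_peMr// -expR0 ler_expR.
  by rewrite divr_ge0// mulr_ge0// sqr_ge0.
apply: (le_trans (bd n)).
rewrite ler_wpM2l// ler_wpM2r ?invr_ge0// ler_expR -mulrA ler_wpM2l// /s.
have : 0 <= 2 / (2 * n.+1%:R + 1) :> R by rewrite divr_ge0 ?addr_ge0 ?mulr_ge0.
(* [pi >= 3] gives [pi ^ 2 / 6 >= 3/2], which exceeds [17/12]. *)
have := pi_ge3; nra.
Qed.

End numeric.

(** * Measurability and independence *)

Section caratheodory_functions.
Context {R : realType} d (E : measurableType d).
Variable K : R -> E -> R.
Hypothesis mK : forall t, measurable_fun setT (K t).
Hypothesis cK : forall x, continuous (K ^~ x).

(** Rounding [t] down to the grid of mesh [1 / (k + 1)] turns preimages into countable unions of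
    rectangles; continuity in [t] then gives [K] as a pointwise limit. *)
Lemma caratheodory_measurable :
  measurable_fun setT (fun z : R * E => K z.1 z.2).
Proof.
pose r k (t : R) : R := (Num.floor (t * k.+1%:R))%:~R / k.+1%:R.
apply: (@measurable_fun_cvg _ _ _ _ (fun k z => K (r k z.1) z.2)); last first.
  move=> [t x] _ /=.
  apply: (@cvg_comp _ _ _ (r ^~ t) (K ^~ x) _ (nbhs t)); last exact: cK.
  apply: (@squeeze_cvgr _ _ _ _ (fun k => t - k.+1%:R^-1) (fun=> t)).
  - near=> k; rewrite /r; have k0 : 0 < k.+1%:R :> R by [].
    rewrite ler_pdivlMr// ler_pdivrMr// mulrBl mulVf ?gt_eqF//.
    rewrite floor_le andbT lerBlDr.
    by rewrite ltW // -(@intrD _ _ 1) floorD1_gt.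
  - rewrite -[X in _ --> X]subr0; apply: cvgB; first exact: cvg_cst.
    exact: cvg_harmonic.
  - exact: cvg_cst.
move=> k _ B mB; rewrite setTI.
have -> : (fun z : R * E => K (r k z.1) z.2) @^-1` B =
  \bigcup_(j : int) ([set t | Num.floor (t * k.+1%:R) = j] `*`
     (K (j%:~R / k.+1%:R) @^-1` B)).
  apply/seteqP; split => [[t x]/= Bx|[t x] [j _ []] /= <-//].
  by exists (Num.floor (t * k.+1%:R)).
apply: countable_bigcupT_measurable => // j; apply: measurableX.
  apply: is_interval_measurable => t1 t2 /= j1 j2 s /andP[s1 s2].
  apply/eqP; rewrite eq_le; apply/andP; split; [rewrite -j2|rewrite -j1];
    by rewrite le_floor ?ler_wpM2r.
by rewrite -[X in measurable X]setTI; exact: mK.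
Unshelve. all: by end_near. Qed.

(** The supremum is uncountable, but by continuity in [t] a value above [c] is also attained above
    [c] at a rational parameter, so superlevel sets are countable unions. *)
Lemma ereal_sup_caratheodory_measurable :
  measurable_fun setT (fun x => ereal_sup (range (fun t => (K t x)%:E))).
Proof.
apply: (measurability _ (ErealGenOInfty.measurableE R)).
move=> _ [_ [c ->] <-]; rewrite setTI.
have -> : (fun x => ereal_sup (range (fun t => (K t x)%:E)))
      @^-1` `]c%:E, +oo[ =
    \bigcup_(q : rat) (K (ratr q) @^-1` `]c, +oo[).
  apply/seteqP; split => x /=.
    rewrite in_itv/= andbT => /ereal_sup_gt[_ [t _ <-]]; rewrite lte_fin => ct.
    have [s [/= ct' [q _ qE]]] : [set s | c < K s x] `&` range ratr !=set0.
      apply: dense_rat; first by exists t.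
      rewrite (_ : [set s | _] = K ^~ x @^-1` [set y | c < y])//.
      by apply: open_comp; [move=> *; exact: cK|exact: open_gt].
    by exists q => //=; rewrite in_itv/= andbT qE.
  move=> [q _ /=]; rewrite !in_itv/= !andbT => cq.
  apply: (@lt_le_trans _ _ (K (ratr q) x)%:E); first by rewrite lte_fin.
  by apply: ereal_sup_ubound; exists (ratr q).
apply: bigcupT_measurable_rat => q.
by rewrite -[X in measurable X]setTI; apply: mK.
Qed.

End caratheodory_functions.

(** * Integration against an independent pair: freezing one variable *)

Section independent_pair.
Local Open Scope ereal_scope.
Context d dU dE {T : measurableType d} {U : measurableType dU}
  {E : measurableType dE} {R : realType} (P : probability T R).
Variables (Y : T -> U) (Z e : T -> E).
Hypotheses (mY : measurable_fun setT Y) (mZ : measurable_fun setT Z)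
  (me : measurable_fun setT e).
Hypothesis indepYZ : forall B C, measurable B -> measurable C ->
  P (Y @^-1` B `&` Z @^-1` C) = P (Y @^-1` B) * P (e @^-1` C).

(** By [indepYZ] the law of [(Y, Z)] agrees on rectangles with the product of the laws of [Y] and
    [e], hence everywhere; Tonelli then integrates the second coordinate with [Y] frozen. *)
Lemma ge0_integral_indep (f : U * E -> \bar R) :
  measurable_fun setT f -> (forall z, 0 <= f z) ->
  \int[P]_w f (Y w, Z w) = \int[P]_w \int[P]_v f (Y w, e v).
Proof.
move=> mf f0.
pose Ym := mfun_Sub (mem_set mY).
pose em := mfun_Sub (mem_set me).
pose YZm := mfun_Sub (mem_set (measurable_fun_pair mY mZ)).
transitivity (\int[distribution P YZm]_z f z).
  by rewrite ge0_integral_distribution.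
transitivity (\int[distribution P Ym \x distribution P em]_z f z).
  apply: eq_measure_integral => A mA _; apply/esym.
  exact: product_measure_unique.
rewrite fubini_tonelli1// ge0_integral_distribution//.
- apply: eq_integral => w _.
  rewrite /= /fubini_F ge0_integral_distribution//.
  by apply: measurableT_comp => //; exact: pair1_measurable.
- exact: measurable_fun_fubini_tonelli_F.
- by move=> u; apply: integral_ge0.
Qed.

Lemma measurable_integral_snd (f : U * E -> \bar R) :
  measurable_fun setT f -> (forall z, 0 <= f z) ->
  measurable_fun setT (fun w => \int[P]_v f (Y w, e v)).
Proof.
move=> mf f0.
pose em := mfun_Sub (mem_set me).
rewrite (_ : (fun w => _) = fubini_F (distribution P em) f \o Y).
  by apply: measurableT_comp => //; exact: measurable_fun_fubini_tonelli_F.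
apply/funext => w; rewrite /= /fubini_F ge0_integral_distribution//.
by apply: measurableT_comp => //; exact: pair1_measurable.
Qed.

End independent_pair.

(** * The natural filtration of the innovations *)

Section filtration.
Context d dE {T : measurableType d} {E : measurableType dE}.
Variable (Z : nat -> T -> E).
Hypothesis mZ : forall n, measurable_fun setT (Z n).

(** These events generate the information carried by [Z 0], ..., [Z n], and they are closed under
    intersection, so two finite measures are compared on them alone. *)
Definition cylinders (n : nat) : set (set T) :=
  [set A | exists2 B : nat -> set E, (forall i, measurable (B i)) &
    A = \bigcap_(i in `I_n.+1) (Z i @^-1` B i)].

Definition natural_filtration n : measurableType _ :=
  g_sigma_algebraType (cylinders n).

Lemma cylinders_measurable n : cylinders n `<=` measurable.
Proof.
move=> A [B mB ->]; apply: bigcap_measurable => [|i _]; first by exists 0%N.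
by rewrite -[X in measurable X]setTI; exact: mZ.
Qed.

Lemma natural_filtration_measurable n (A : set T) :
  measurable (A : set (natural_filtration n)) -> measurable A.
Proof.
apply: smallest_sub; first exact: sigma_algebra_measurable.
exact: cylinders_measurable.
Qed.

Lemma natural_filtration_coord n m : (m <= n)%N ->
  measurable_fun [set: natural_filtration n] (Z m : natural_filtration n -> E).
Proof.
move=> mn _ B mB; rewrite setTI; apply: sub_sigma_algebra.
exists (fun i => if i == m then B else setT).
  by move=> i; case: ifP.
apply/seteqP; split => [w Bw i _ /=|w /(_ m mn)/=]; rewrite ?eqxx//.
by case: eqP => // ->.
Qed.

Lemma natural_filtration_sub n (A : set T) :
  measurable (A : set (natural_filtration n)) ->
  measurable (A : set (natural_filtration n.+1)).
Proof.
apply: smallest_sub; first exact: sigma_algebra_measurable.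
move=> _ [B mB ->]; apply: bigcap_measurable => [|i /= ni].
  by exists 0%N.
rewrite -[X in measurable X]setTI.
by apply: natural_filtration_coord => //; exact: leqW.
Qed.

Lemma measurable_fun_filtration n dU (U : measurableType dU) (f : T -> U) :
  measurable_fun [set: natural_filtration n] (f : natural_filtration n -> U) ->
  measurable_fun setT f.
Proof.
move=> mf _ B mB; rewrite setTI; apply: (@natural_filtration_measurable n).
by rewrite -[X in measurable X]setTI; exact: mf.
Qed.

Lemma measurable_fun_filtration_sub n dU (U : measurableType dU) (f : T -> U) :
  measurable_fun [set: natural_filtration n] (f : natural_filtration n -> U) ->
  measurable_fun [set: natural_filtration n.+1]
    (f : natural_filtration n.+1 -> U).
Proof.
move=> mf _ B mB; rewrite setTI; apply: natural_filtration_sub.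
by rewrite -[X in measurable X]setTI; exact: mf.
Qed.

Context {R : realType} (P : probability T R) (e : T -> E).
Local Open Scope ereal_scope.

(** One formula for two facts: the next innovation is independent of the past, and it has the law of
    [e]. Taking every [B i] equal to [setT] isolates the second. *)
Definition iid_innovations :=
  forall n (B : nat -> set E) (C : set E),
  (forall i, measurable (B i)) -> measurable C ->
  P (\bigcap_(i in `I_n.+1) (Z i @^-1` B i) `&` Z n.+1 @^-1` C) =
  P (\bigcap_(i in `I_n.+1) (Z i @^-1` B i)) * P (e @^-1` C).

(** As functions of [A], both sides are finite measures: [P] restricted to an event of [Z n.+1], and
    a multiple of [P]. They agree on the pi-system of cylinders, hence on the sigma-algebra that it
    generates. *)
Lemma natural_filtration_indep n (A : set T) (C : set E) :
  iid_innovations -> measurable (A : set (natural_filtration n)) -> measurable C ->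
  P (A `&` Z n.+1 @^-1` C) = P A * P (e @^-1` C).
Proof.
move=> iid mA mC.
have mZC : measurable (Z n.+1 @^-1` C).
  by rewrite -[X in measurable X]setTI; exact: mZ.
have cylT : cylinders n setT.
  exists (fun=> setT) => //; apply/seteqP; split => // w _ i _ //.
have lawZ : P (Z n.+1 @^-1` C) = P (e @^-1` C).
  have [B mB BT] := cylT.
  by have := iid n B C mB mC; rewrite -BT setTI probability_setT mul1e.
have p_fin : P (Z n.+1 @^-1` C) \is a fin_num by exact: fin_num_measure.
have p0 : (0 <= fine (P (Z n.+1 @^-1` C)))%R by rewrite fine_ge0.
pose m1 : {measure set T -> \bar R} := mrestr P mZC.
pose m2 : {measure set T -> \bar R} := mscale (NngNum p0) P.
suff : m1 A = m2 A.
  rewrite /m1/= /mrestr => ->.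
  by rewrite /m2/= /mscale/= fineK// lawZ muleC.
have HE : [set X | cylinders n X /\ X `<=` setT] = cylinders n.
  by apply/seteqP; split => [X []|X ?]//; split.
apply: (g_sigma_algebra_measure_unique_trace (cylinders n) setT) => //.
- by rewrite HE; exact: cylinders_measurable.
- rewrite HE => _ _ [B mB ->] [B' mB' ->].
  exists (fun i => B i `&` B' i); first by move=> i; exact: measurableI.
  by rewrite -bigcapI.
- rewrite /m1 /m2/= /mrestr/= /mscale/= setTI probability_setT mule1 fineK//.
- move=> _ [[B mB ->] _].
  rewrite /m1 /m2/= /mrestr/= /mscale/= fineK// lawZ muleC.
  exact: iid.
- by rewrite /m1/= /mrestr setTI ltey_eq p_fin.
- by rewrite HE.
Qed.

Let measurable_id_filtration n :
  measurable_fun setT (id : T -> natural_filtration n).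
Proof.
by move=> _ B mB; rewrite setTI; exact: natural_filtration_measurable mB.
Qed.

Lemma measurable_integral_filtration n
    (f : natural_filtration n * E -> \bar R) :
  measurable_fun setT e -> measurable_fun setT f -> (forall z, 0 <= f z) ->
  measurable_fun [set: T] (fun w : T => \int[P]_v f (w, e v)).
Proof.
move=> me mf f0.
exact: (@measurable_integral_snd _ _ _ _ _ _ _ P _ _
  (@measurable_id_filtration n) me f mf f0).
Qed.

Lemma ge0_integral_filtration n (f : natural_filtration n * E -> \bar R) :
  measurable_fun setT e -> iid_innovations -> measurable_fun setT f ->
  (forall z, 0 <= f z) ->
  \int[P]_w f (w, Z n.+1 w) = \int[P]_w \int[P]_v f (w, e v).
Proof.
move=> me iid mf f0.
apply: (ge0_integral_indep (@measurable_id_filtration n) (mZ n.+1)) => // B C mB mC.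
exact: natural_filtration_indep.
Qed.

End filtration.

(** * The projected Robbins-Monro recursion *)

Section clip.
Context {R : realType}.
Implicit Types a b x y t : R.

Lemma clip_itv a b x : a <= b -> a <= clip a b x <= b.
Proof. by move=> ab; rewrite /clip; do ! case: ifPn; lra. Qed.

Lemma clip_id a b x : a <= x <= b -> clip a b x = x.
Proof. by rewrite /clip; do ! case: ifPn; lra. Qed.

Lemma clip_dist a b x y : a <= b -> `|clip a b x - clip a b y| <= `|x - y|.
Proof.
move=> ab; rewrite ler_norml.
have := ler_norm (x - y); have := ler_norm (- (x - y)); rewrite normrN.
by rewrite /clip; do ! case: ifPn; lra.
Qed.

Lemma clip_continuous a b : a <= b -> continuous (clip a b).
Proof.
move=> ab x; apply/cvgrPdist_le => /= eps eps0; near=> y.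
apply: le_trans (clip_dist _ _ ab) _.
by near: y; move: eps eps0; apply/cvgrPdist_le; exact: cvg_id.
Unshelve. all: by end_near. Qed.

Lemma clip_sqr_le a b x t : a <= b -> a <= t <= b ->
  (clip a b x - t) ^+ 2 <= (x - t) ^+ 2.
Proof.
move=> ab tab; rewrite -(clip_id tab) -[leLHS]real_normK ?num_real//.
rewrite [in leRHS]clip_id// -{2}(clip_id tab) -[leRHS]real_normK ?num_real//.
rewrite lerXn2r ?nnegrE//.
by apply: le_trans (clip_dist _ _ ab) _; rewrite clip_id.
Qed.

End clip.

(** The slack [2 * c - c'] absorbs the quadratic term as soon as [n + 1] exceeds
    [C / (2 * c - c')]. *)
Lemma step_factor_le {R : realType} (c c' C : R) : c' < 2 * c ->
  exists N, forall n, (N <= n)%N ->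
    1 - 2 * c / n.+1%:R + C / n.+1%:R ^+ 2 <= 1 - c' / n.+1%:R.
Proof.
move=> cc'; exists (Num.truncn (C / (2 * c - c'))) => n Nn.
have [k kE] : exists k : R, k = n.+1%:R by exists n.+1%:R.
have k0 : 0 < k by rewrite kE.
have : C / (2 * c - c') <= k.
  apply: (le_trans (ltW (truncnS_gt _))).
  by rewrite kE ler_nat ltnS.
rewrite -kE ler_pdivrMr ?subr_gt0// => hC.
rewrite -subr_ge0.
have -> : 1 - c' / k - (1 - 2 * c / k + C / k ^+ 2) =
  (k * (2 * c - c') - C) / k ^+ 2 by field; rewrite gt_eqF.
by rewrite divr_ge0 ?subr_ge0// sqr_ge0.
Qed.

(** * Projected recursion driven by a general random field [H] *)

Section projected_robbins_monro.
Context {R : realType} d dE {T : measurableType d} {E : measurableType dE}.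
Variables (P : probability T R) (Z : nat -> T -> E) (e : T -> E).
Hypothesis mZ : forall n, measurable_fun setT (Z n).
Hypothesis me : measurable_fun setT e.
Hypothesis iid : iid_innovations Z P e.
Variables (a b theta theta0 C : R) (H : R -> E -> R).
Hypothesis theta_ab : a <= theta <= b.
Hypothesis theta0_ab : a <= theta0 <= b.
Hypothesis mH : forall t, measurable_fun setT (H t).
Hypothesis cH : forall x, continuous (H ^~ x).
Hypothesis intH2 : forall t, a <= t <= b ->
  P.-integrable setT (EFin \o (fun w => (H t (e w)) ^+ 2)).
Hypothesis H2_le : forall t, a <= t <= b ->
  \int[P]_w (H t (e w)) ^+ 2 <= C * (t - theta) ^+ 2.

Let m t := \int[P]_w H t (e w).

Let ab : a <= b.
Proof. by case/andP: theta_ab; exact: le_trans. Qed.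

Fixpoint prm (n : nat) (w : T) : R :=
  if n is k.+1 then
    clip a b (prm k w - k.+1%:R^-1 * H (prm k w) (Z k.+1 w))
  else theta0.

Let V n w := (prm n w - theta) ^+ 2.

Lemma prm_itv n w : a <= prm n w <= b.
Proof. by case: n => [//|n]; exact: clip_itv. Qed.

Lemma measurable_prm_step (g : R) :
  measurable_fun setT (fun z : R * E => clip a b (z.1 - g * H z.1 z.2)).
Proof.
apply: (@measurableT_comp _ _ _ _ _ _ (clip a b)).
  by apply: continuous_measurable_fun; exact: clip_continuous.
apply: measurable_funB; first exact: measurable_fst.
by apply: measurable_funM => //; exact: caratheodory_measurable.
Qed.

Lemma prm_adapted n :
  measurable_fun [set: natural_filtration Z n]
    (prm n : natural_filtration Z n -> R).
Proof.
elim: n => [|n IH]; first exact: measurable_cst.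
apply: (@measurableT_comp _ _ _ _ _ _
  (fun z : R * E => clip a b (z.1 - n.+1%:R^-1 * H z.1 z.2)) _
  (fun w : natural_filtration Z n.+1 => (prm n w, Z n.+1 w))).
  exact: measurable_prm_step.
apply: measurable_fun_pair; first exact: measurable_fun_filtration_sub.
exact: natural_filtration_coord.
Qed.

Lemma measurable_prm n : measurable_fun setT (prm n).
Proof. exact: (measurable_fun_filtration mZ (@prm_adapted n)). Qed.

Lemma sqr_itv_le x : a <= x <= b -> (x - theta) ^+ 2 <= (b - a) ^+ 2.
Proof. by case/andP: theta_ab => ? ? /andP[? ?]; nra. Qed.

Lemma integrable_prm_sqr n A : measurable A ->
  P.-integrable A (EFin \o V n).
Proof.
move=> mA; apply: measurable_bounded_integrable => //.
- by rewrite (le_lt_trans (probability_le1 P mA))// ltry.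
- apply: (measurable_funS measurableT) => //.
  apply: measurable_funX; apply: measurable_funB => //.
  exact: measurable_prm.
- exists ((b - a) ^+ 2); split; first exact: num_real.
  move=> M hM w Aw /=; rewrite ger0_norm ?sqr_ge0//.
  by rewrite (le_trans (sqr_itv_le (prm_itv n w)))// ltW.
Qed.

(** Clipping does not increase the distance to [theta], so it can be removed. In the expanded
    square, [hc] controls the cross term and [H2_le] the quadratic one. *)
Lemma prm_drift_le t (g c : R) : a <= t <= b -> 0 <= g ->
  c * (t - theta) ^+ 2 <= (t - theta) * m t ->
  (\int[P]_v ((clip a b (t - g * H t (e v)) - theta) ^+ 2)%:E <=
   ((1 - 2 * c * g + C * g ^+ 2) * (t - theta) ^+ 2)%:E)%E.
Proof.
move=> tab g0 hc.
have mHe : measurable_fun setT (fun w => H t (e w)).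
  by apply: measurableT_comp.
have intD f1 f2 : P.-integrable setT (EFin \o f1) ->
    P.-integrable setT (EFin \o f2) ->
    P.-integrable setT (EFin \o (fun w => f1 w + f2 w)).
  by move=> ? ?; exact: (@integrableD _ _ _ P setT measurableT
    (EFin \o f1) (EFin \o f2)).
have intc k : P.-integrable setT (EFin \o cst k).
  exact: finite_measure_integrable_cst.
have intH : P.-integrable setT (EFin \o (fun w => H t (e w))).
  apply: (@le_integrable _ _ _ _ _ _ _ (EFin \o (fun w => 1 + (H t (e w)) ^+ 2))) => //.
  - exact/measurable_EFinP.
  - move=> w _ /=; rewrite lee_fin [leRHS]ger0_norm ?addr_ge0 ?sqr_ge0//.
    by rewrite ler_norml; set h := H _ _; nra.
  - by apply: intD; [exact: intc|exact: intH2].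
pose q w := (t - theta) ^+ 2 + (- (2 * g * (t - theta)) * H t (e w) +
  g ^+ 2 * (H t (e w)) ^+ 2).
have intHl k : P.-integrable setT (EFin \o (fun w => k * H t (e w))).
  exact: (integrableZl measurableT k intH).
have intH2l k : P.-integrable setT (EFin \o (fun w => k * (H t (e w)) ^+ 2)).
  exact: (integrableZl measurableT k (intH2 tab)).
have intS := intD _ _ (intHl (- (2 * g * (t - theta)))) (intH2l (g ^+ 2)).
have intq : P.-integrable setT (EFin \o q) by exact: (intD _ _ (intc _) intS).
apply: (@le_trans _ _ (\int[P]_v (q v)%:E)%E).
  apply: ge0_le_integral => //.
  - by move=> v _; rewrite lee_fin sqr_ge0.
  - apply/measurable_EFinP/measurable_funX; apply: measurable_funB => //.
    apply: (@measurableT_comp _ _ _ _ _ _ (clip a b)).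
      by apply: continuous_measurable_fun; exact: clip_continuous.
    by apply: measurable_funB => //; exact: measurable_funM.
  - exact: (measurable_int _ intq).
  - move=> v _; rewrite lee_fin.
    apply: le_trans (clip_sqr_le _ ab theta_ab) _.
    by rewrite le_eqVlt; apply/orP; left; apply/eqP; rewrite /q; ring.
rewrite -[leLHS]fineK ?integrable_fin_num// lee_fin.
rewrite -/(Rintegral P setT q) /q (RintegralD measurableT (intc _) intS)
  (RintegralD measurableT (intHl _) (intH2l _))
  (RintegralZl _ measurableT intH) (RintegralZl _ measurableT (intH2 tab)).
rewrite [X in X + _](_ : _ = (t - theta) ^+ 2); last first.
  rewrite (Rintegral_cst P measurableT).
  by rewrite [X in fine X]probability_setT mulr1.
rewrite -/(m t).
have := H2_le tab; set I2 := Rintegral _ _ _ => hI2.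
have : g ^+ 2 * I2 <= g ^+ 2 * (C * (t - theta) ^+ 2).
  by rewrite ler_wpM2l// sqr_ge0.
have : g * (c * (t - theta) ^+ 2) <= g * ((t - theta) * m t).
  by rewrite ler_wpM2l.
lra.
Qed.

(** Since [A] and [prm n] depend on the past only, they can be frozen while the new innovation is
    integrated out; [prm_drift_le] then applies pointwise, and the drift inequality is used only on
    [A]. *)
Lemma prm_one_step n (A : set T) (c : R) :
  measurable (A : set (natural_filtration Z n)) ->
  (forall w, A w -> c * V n w <= (prm n w - theta) * m (prm n w)) ->
  \int[P]_(w in A) V n.+1 w <=
  (1 - 2 * c / n.+1%:R + C / n.+1%:R ^+ 2) * \int[P]_(w in A) V n w.
Proof.
move=> mA hA.
have mA' : measurable A by exact: natural_filtration_measurable mA.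
set rho := (X in X * _).
have rhoE : rho = 1 - 2 * c * n.+1%:R^-1 + C * n.+1%:R^-1 ^+ 2.
  by rewrite /rho exprVn.
rewrite -RintegralZl//; last exact: integrable_prm_sqr.
rewrite /Rintegral fine_le//.
- by apply: integrable_fin_num => //; exact: integrable_prm_sqr.
- apply: integrable_fin_num => //.
  exact: (integrableZl mA' _ (integrable_prm_sqr n mA')).
(* The first coordinate carries the past, the second the new innovation. *)
pose f (z : natural_filtration Z n * E) : \bar R :=
  ((\1_A z.1 : R) *
   (clip a b (prm n z.1 - n.+1%:R^-1 * H (prm n z.1) z.2) - theta) ^+ 2)%:E.
have f0 z : (0 <= f z)%E by rewrite lee_fin mulr_ge0 ?sqr_ge0.
have mf : measurable_fun setT f.
  apply/measurable_EFinP/measurable_funM.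
    apply: (@measurableT_comp _ _ _ _ _ _ (\1_A : natural_filtration Z n -> R)).
      exact: measurable_indic.
    exact: measurable_fst.
  apply: measurable_funX; apply: measurable_funB => //.
  apply: (@measurableT_comp _ _ _ _ _ _
    (fun z : R * E => clip a b (z.1 - n.+1%:R^-1 * H z.1 z.2)) _
    (fun z : natural_filtration Z n * E => (prm n z.1, z.2))).
    exact: measurable_prm_step.
  apply: measurable_fun_pair; last exact: measurable_snd.
  apply: (measurableT_comp (@prm_adapted n)); exact: measurable_fst.
rewrite integral_mkcond [leRHS]integral_mkcond.
have -> : (\int[P]_w ((fun w => (V n.+1 w)%:E) \_ A) w =
    \int[P]_w f (w, Z n.+1 w))%E.
  apply: eq_integral => w _; rewrite /patch /f/= indicE.
  by case: ifPn => _; rewrite ?mul1r ?mul0r.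
rewrite (ge0_integral_filtration mZ me iid mf f0).
apply: ge0_le_integral => //.
- by move=> w _; exact: integral_ge0.
- exact: (measurable_integral_filtration mZ P me mf f0).
- apply/(measurable_restrictT _ mA'); apply/measurable_EFinP.
  apply: measurable_funM => //; apply/measurable_EFinP.
  exact: measurable_int (integrable_prm_sqr n mA').
- move=> w _.
  rewrite /patch /f/=; case: ifPn => wA; last first.
    by rewrite indicE (negbTE wA) integral0_eq// => v _; rewrite mul0r.
  rewrite rhoE.
  apply: le_trans (prm_drift_le (prm_itv n w) _ (hA w (set_mem wA))) => //.
  by under eq_integral do rewrite indicE wA mul1r.
Qed.

Lemma prm_one_stepT n (c : R) :
  (forall t, a <= t <= b -> c * (t - theta) ^+ 2 <= (t - theta) * m t) ->
  \int[P]_w V n.+1 w <=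
  (1 - 2 * c / n.+1%:R + C / n.+1%:R ^+ 2) * \int[P]_w V n w.
Proof.
by move=> hc; apply: prm_one_step => // w _; apply: hc; exact: prm_itv.
Qed.

Lemma Rintegral_prm_sqr_ge0 n A : 0 <= \int[P]_(w in A) V n w.
Proof. by apply: Rintegral_ge0 => w _; exact: sqr_ge0. Qed.

(** With [c = 1/2] the linear coefficient [2 * c] is exactly [1], the case treated by
    [rate_one_rec_bound]. *)
Lemma prm_rate : 0 <= C ->
  (forall t, a <= t <= b -> 2^-1 * (t - theta) ^+ 2 <= (t - theta) * m t) ->
  forall n, \int[P]_w V n w <=
    (theta0 - theta) ^+ 2 * (expR (C * pi ^+ 2 / 6) / n.+1%:R).
Proof.
move=> C0 hm n.
have u0 : \int[P]_w V 0 w = (theta0 - theta) ^+ 2.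
  have := Rintegral_cst P measurableT ((theta0 - theta) ^+ 2).
  by rewrite [X in fine X]probability_setT mulr1.
rewrite -u0.
apply: (@rate_one_rec_bound R (fun n => \int[P]_w V n w)) => // k.
  exact: Rintegral_prm_sqr_ge0.
by have := prm_one_stepT k hm; rewrite divff// mul1r.
Qed.

(** * Localisation near [theta] and convergence in probability *)

Section convergence_in_probability.
Variables (c0 c del : R).
Hypotheses (c0_gt0 : 0 < c0) (c_gt : 1 < 2 * c) (del0 : 0 < del).
Hypothesis m_global :
  forall t, a <= t <= b -> c0 * (t - theta) ^+ 2 <= (t - theta) * m t.
Hypothesis m_local : forall t, a <= t <= b -> (t - theta) ^+ 2 <= del ->
  c * (t - theta) ^+ 2 <= (t - theta) * m t.

Lemma prm_sqr_mean_cvg : \int[P]_w V n w @[n --> \oo] --> 0.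
Proof.
have cc : c0 < 2 * c0 by have := c0_gt0; lra.
have [N hN] := step_factor_le C cc.
apply: (@harmonic_rec_cvg R (fun n => \int[P]_w V n w) c0 N) => // n.
  exact: Rintegral_prm_sqr_ge0.
move=> Nn; apply: le_trans (prm_one_stepT n m_global) _.
by rewrite ler_wpM2r ?Rintegral_prm_sqr_ge0// hN.
Qed.

(** This event is decided by the past up to time [n], so [prm_one_step] applies on it; for [n < N]
    it is the whole space. *)
Let stay N n := [set w | forall k, (N <= k <= n)%N -> V k w <= del].

Let stayS N n : (N <= n.+1)%N ->
  stay N n.+1 = stay N n `&` [set w | V n.+1 w <= del].
Proof.
move=> Nn; apply/seteqP; split => [w h|w [h1 h2] k /andP[Nk]].
  split=> [k /andP[Nk kn]|]; apply: h; first by rewrite Nk leqW.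
  by rewrite Nn /=.
by rewrite leq_eqVlt => /predU1P[->//|kn]; apply: h1; rewrite Nk.
Qed.

Let stayN N n : (n < N)%N -> stay N n = setT.
Proof.
move=> nN; apply/seteqP; split => // w _ k /andP[Nk kn].
by move: (leq_trans Nk kn); rewrite leqNgt nN.
Qed.

Let measurable_small n :
  measurable ([set w | V n w <= del] : set (natural_filtration Z n)).
Proof.
have mV : measurable_fun [set: natural_filtration Z n]
    (V n : natural_filtration Z n -> R).
  apply: measurable_funX; apply: measurable_funB => //; exact: prm_adapted.
have -> : [set w | V n w <= del] = setT `&` (V n @^-1` `]-oo, del]).
  by rewrite setTI; apply/seteqP; split => w; rewrite /= in_itv.
exact: mV.
Qed.

Let measurable_stay N n :
  measurable (stay N n : set (natural_filtration Z n)).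
Proof.
elim: n => [|n IH].
  case: N => [|N]; last by rewrite stayN.
  have -> : stay 0%N 0%N = [set w | V 0 w <= del] by
    apply/seteqP; split => [w /(_ 0%N)|w h [|k]]//=; exact.
  exact: measurable_small.
have [Nn|nN] := leqP N n.+1; last by rewrite stayN.
rewrite stayS//; apply: measurableI; last exact: measurable_small.
exact: natural_filtration_sub.
Qed.

Let measurable_stayT N n : measurable (stay N n).
Proof. exact: (natural_filtration_measurable mZ (@measurable_stay N n)). Qed.

(** Markov's inequality, restricted to [A]. *)
Let large_le n A : measurable A -> (forall w, A w -> del <= V n w) ->
  del * fine (P A) <= \int[P]_(w in A) V n w.
Proof.
move=> mA hA; rewrite -Rintegral_cst//; apply: le_Rintegral => //.
- exact: finite_measure_integrable_cst.
- exact: integrable_prm_sqr.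
Qed.

Let stay_split n A B : measurable A -> measurable B -> B `<=` A ->
  \int[P]_(w in A) V n w =
  \int[P]_(w in B) V n w + \int[P]_(w in A `\` B) V n w.
Proof.
move=> mA mB BA.
rewrite -{1}(setDUK BA) Rintegral_setU//.
- exact: measurableD.
- by rewrite setDUK//; exact: integrable_prm_sqr.
- by apply/disj_setPS => w [Bw [_]]; exact.
Qed.

(** Paths that leave at time [n + 1] have [V n.+1 > del]. By [large_le], the integral they remove is
    at least [del] times the probability added to the complement. *)
Let stay_step N n : (N <= n)%N ->
  \int[P]_(w in stay N n.+1) V n.+1 w + del * fine (P (~` stay N n.+1)) <=
  (1 - 2 * c / n.+1%:R + C / n.+1%:R ^+ 2) * \int[P]_(w in stay N n) V n w +
  del * fine (P (~` stay N n)).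
Proof.
move=> Nn.
have sub : stay N n.+1 `<=` stay N n by rewrite stayS ?leqW//; exact: subIsetl.
have := @prm_one_step n _ c (@measurable_stay N n).
have hV w : stay N n w -> c * V n w <= (prm n w - theta) * m (prm n w).
  by move=> /(_ n); rewrite Nn leqnn => /(_ isT); apply: m_local; exact: prm_itv.
move=> /(_ hV).
rewrite (@stay_split n.+1 _ _ _ _ sub)//.
have mD : measurable (stay N n `\` stay N n.+1) by exact: measurableD.
have hD : del * fine (P (stay N n `\` stay N n.+1)) <=
    \int[P]_(w in stay N n `\` stay N n.+1) V n.+1 w.
  apply: large_le => // w [sn nsn]; rewrite leNgt; apply/negP => /ltW h.
  by apply: nsn; rewrite stayS ?leqW.
have -> : fine (P (~` stay N n.+1)) =
    fine (P (~` stay N n)) + fine (P (stay N n `\` stay N n.+1)).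
  rewrite -fineD ?fin_num_measure//; last exact: measurableC.
  rewrite -measureU//; last 2 first.
  - exact: measurableC.
  - by apply/seteqP; split => // w [nsn []].
  congr (fine (P _)); apply/seteqP; split => [w nw|w [nw|[]]]//.
    by have [sw|] := pselect (stay N n w); [right|left].
  by apply: contra_not nw; exact: sub.
move=> h; rewrite mulrDr addrCA [leRHS]addrC lerD2l.
by apply: le_trans h; rewrite lerD2l.
Qed.

Lemma prm_cvg_probability (eta : R) : 0 < eta ->
  fine (P [set w | eta < n%:R * V n w]) @[n --> \oo] --> 0.
Proof.
move=> eta0.
have mL n : measurable [set w | eta < n%:R * V n w].
  have mV : measurable_fun setT (fun w => n%:R * V n w).
    apply: measurable_funM => //; apply: measurable_funX.
    by apply: measurable_funB => //; exact: measurable_prm.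
  have -> : [set w | eta < n%:R * V n w] =
      setT `&` ((fun w => n%:R * V n w) @^-1` `]eta, +oo[).
    by rewrite setTI; apply/seteqP; split => w; rewrite /= in_itv/= andbT.
  exact: mV.
(* The midpoint of [1] and [2 * c] leaves room both to absorb [C / n ^ 2] and to beat the rate
   [1 / n]. *)
pose c' := (1 + 2 * c) / 2.
have c'1 : 1 < c' by have := c_gt; rewrite /c'; lra.
have cc : c' < 2 * c by have := c_gt; rewrite /c'; lra.
have [N1 hN1] := step_factor_le C cc.
apply/cvgrPdist_le => /= eps eps0.
(* This initial bound on [u + del * p] will force [p n <= eps / 2] for every [n >= N]. *)
have /cvgrPdist_le/(_ (del * (eps / 2))) := prm_sqr_mean_cvg.
have de : 0 < del * (eps / 2) by rewrite mulr_gt0// divr_gt0.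
move=> /(_ de)[N2 _ hN2].
pose N := maxn N1 N2.
pose u n := \int[P]_(w in stay N n) V n w.
pose p n := fine (P (~` stay N n)).
have u0 n : 0 <= u n by exact: Rintegral_prm_sqr_ge0.
have p0 n : 0 <= p n by rewrite fine_ge0.
have fac n : (N <= n)%N ->
    1 - 2 * c / n.+1%:R + C / n.+1%:R ^+ 2 <= 1 - c' / n.+1%:R.
  by move=> Nn; apply: hN1; rewrite (leq_trans _ Nn)// leq_maxl.
have stepN n : (N <= n)%N -> u n.+1 + del * p n.+1 <=
    (1 - c' / n.+1%:R) * u n + del * p n.
  move=> Nn; apply: le_trans (stay_step Nn) _.
  by rewrite lerD2r; apply: ler_wpM2r; [exact: u0|exact: fac].
have mono n : (N <= n)%N -> p n <= p n.+1.
  move=> Nn; rewrite fine_le ?fin_num_measure//; try exact: measurableC.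
  rewrite le_measure ?inE//; try exact: measurableC.
  by apply: subsetC; rewrite stayS ?leqW//; exact: subIsetl.
have cvg_u : n%:R * u n @[n --> \oo] --> 0.
  apply: (@harmonic_rec_cvg_lin R u c' N) => // n Nn.
  rewrite -(lerD2r (del * p n)); apply: le_trans (stepN n Nn).
  by rewrite lerD2l ler_wpM2l ?(ltW del0)// mono.
have init : u N + del * p N <= \int[P]_w V N w.
  rewrite (@stay_split N setT (stay N N))// lerD2l setTD.
  apply: large_le; first exact: measurableC.
  move=> w nsw; rewrite leNgt; apply/negP => /ltW h; apply: nsw => k.
  by rewrite -eqn_leq => /eqP <-.
have pN n : (N <= n)%N -> u n + del * p n <= del * (eps / 2).
  move=> /subnKC <-; elim: (n - N)%N => [|k IH].
    rewrite addn0; apply: (le_trans init).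
    have := hN2 N (leq_maxr _ _); rewrite sub0r normrN ger0_norm//.
    exact: Rintegral_prm_sqr_ge0.
  rewrite addnS; apply: le_trans (stepN _ (leq_addr _ _)) _.
  apply: le_trans IH; rewrite lerD2r ler_piMl// gerBl divr_ge0//; lra.
have /cvgrPdist_le/(_ (eta * (eps / 2))) := cvg_u.
have ee : 0 < eta * (eps / 2) by rewrite mulr_gt0// divr_gt0.
move=> /(_ ee)[N3 _ hN3].
exists (maxn N N3) => // n /=; rewrite geq_max => /andP[Nn N3n].
rewrite sub0r normrN ger0_norm; last by rewrite fine_ge0.
have := hN3 n N3n; rewrite sub0r normrN ger0_norm ?mulr_ge0// => h3.
have := pN n Nn => hp.
set L := [set w | _].
have mLn : measurable L by exact: mL.
have mS : measurable (stay N n `&` L) by exact: measurableI.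
(* Either the path has left the neighbourhood, with probability [p n], or Markov's inequality for
   [u n] applies; each part contributes at most [eps / 2]. *)
have : fine (P L) <= p n + fine (P (stay N n `&` L)).
  rewrite -fineD ?fin_num_measure//; last exact: measurableC.
  rewrite fine_le ?fin_num_measure//.
    by rewrite fin_numD !fin_num_measure//; exact: measurableC.
  apply: le_trans (measureU2 _ _ _) => //; last exact: measurableC.
  rewrite le_measure ?inE//; first by apply: measurableU => //; exact: measurableC.
  move=> w Lw; have [sw|nw] := pselect (stay N n w); last by left.
  by right.
have : eta * fine (P (stay N n `&` L)) <= n%:R * u n.
  rewrite -Rintegral_cst//.
  apply: (@le_trans _ _ (\int[P]_(w in stay N n `&` L) (n%:R * V n w))).
    apply: le_Rintegral => //.
    - exact: finite_measure_integrable_cst.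
    - exact: (integrableZl mS n%:R (integrable_prm_sqr n mS)).
    - by move=> w [_ /ltW].
  rewrite RintegralZl//; last exact: integrable_prm_sqr.
  rewrite ler_wpM2l// /u (@stay_split n (stay N n) (stay N n `&` L))//.
  by rewrite lerDl Rintegral_prm_sqr_ge0.
have : del * p n <= del * (eps / 2) by have := u0 n; lra.
rewrite ler_pM2l// => hpn h4 h5.
have : eta * fine (P (stay N n `&` L)) <= eta * (eps / 2) by lra.
rewrite ler_pM2l//; lra.
Qed.

End convergence_in_probability.

End projected_robbins_monro.

(** * Convergence in law to a Dirac mass, trace sigma-algebras *)

Section convergence_to_dirac.
Context {R : realType} d {T : measurableType d} (P : probability T R).

(** Where [Y n ^ 2 <= eta], continuity of [f] at [0] makes the error at most [eps / 2]; elsewhere it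
    is at most [2 * C], on an event of vanishing probability. *)
Lemma cvg_in_distribution_dirac (Y : nat -> T -> R) :
  (forall n, measurable_fun setT (Y n)) ->
  (forall eta : R, 0 < eta ->
    fine (P [set w | eta < Y n w ^+ 2]) @[n --> \oo] --> 0) ->
  cvg_in_distribution P Y \d_(0 : R).
Proof.
move=> mY Ycvg; split=> // f cf [C fC].
have mf : measurable_fun setT f by exact: continuous_measurable_fun.
have C0 : 0 <= C by apply: le_trans (fC 0); exact: normr_ge0.
rewrite integral_dirac//; last exact/measurable_EFinP.
rewrite diracT mul1e.
have mfY n : measurable_fun setT (f \o Y n) by exact: measurableT_comp.
have ibd (g : T -> R) (K : R) : measurable_fun setT g ->
    (forall w, `|g w| <= K) -> P.-integrable setT (EFin \o g).
  move=> mg gK; apply: measurable_bounded_integrable => //.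
    by rewrite (le_lt_trans (probability_le1 P measurableT))// ltry.
  exists K; split; first exact: num_real.
  by move=> M KM w _ /=; rewrite (le_trans (gK w))// ltW.
have iY n : P.-integrable setT (EFin \o (f \o Y n)) by apply: ibd => // w /=.
have -> : (fun n => 'E_P[f \o Y n]%E) = EFin \o (fun n => \int[P]_w f (Y n w)).
  apply/funext => n; rewrite unlock /= /Rintegral fineK//.
  exact: integrable_fin_num (iY n).
apply: cvg_EFin; first exact: nearW.
apply/cvgrPdist_le => /= eps eps0.
have /cvgrPdist_lt/(_ (eps / 2)) := cf 0.
have e2 : 0 < eps / 2 by rewrite divr_gt0.
move=> /(_ e2)/nbhs_ballP[del /= del0 hdel].
pose eta := (del / 2) ^+ 2.
have eta0 : 0 < eta by rewrite exprn_gt0// divr_gt0.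
have hsmall y : y ^+ 2 <= eta -> `|f 0 - f y| <= eps / 2.
  move=> yeta; apply/ltW/hdel; rewrite /ball/= sub0r normrN.
  have : `|y| <= del / 2.
    by rewrite -ler_sqr ?nnegrE ?real_normK ?num_real// ltW// divr_gt0.
  by move=> h; apply: (le_lt_trans h); lra.
have mL n : measurable [set w | eta < Y n w ^+ 2].
  have mY2 : measurable_fun setT (fun w => Y n w ^+ 2).
    exact: measurable_funX.
  have -> : [set w | eta < Y n w ^+ 2] =
      setT `&` ((fun w => Y n w ^+ 2) @^-1` `]eta, +oo[).
    by rewrite setTI; apply/seteqP; split => w; rewrite /= in_itv/= andbT.
  exact: mY2.
have C1 : 0 < 4 * C + 1 by lra.
(* Chosen so that [2 * C * P L <= eps / 2]; the [+ 1] keeps the denominator positive when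
   [C = 0]. *)
have /cvgrPdist_le/(_ (eps / (4 * C + 1))) := Ycvg _ eta0.
have e4 : 0 < eps / (4 * C + 1) by rewrite divr_gt0.
move=> /(_ e4); apply: filterS => n.
rewrite sub0r normrN ger0_norm ?fine_ge0// => hn.
have f0E : f 0 = \int[P]_w cst (f 0) w.
  by rewrite (Rintegral_cst P measurableT) [X in fine X]probability_setT mulr1.
have ic0 : P.-integrable setT (EFin \o cst (f 0)).
  exact: finite_measure_integrable_cst.
rewrite f0E -(RintegralB measurableT ic0 (iY n)).
set L := [set w | _] in hn.
have idiff : P.-integrable setT (EFin \o (fun w => cst (f 0) w - (f \o Y n) w)).
  apply: (@ibd _ (C + C)); first by apply: measurable_funB => //; exact: mfY.
  by move=> w; apply: (le_trans (ler_normB _ _)); apply: lerD; exact: fC.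
apply: (le_trans (le_normr_Rintegral measurableT idiff)).
have iI : P.-integrable setT (EFin \o (\1_L : T -> R)).
  apply: (@ibd _ 1); first exact: measurable_indic (mL n).
  by move=> w; rewrite indicE; case: (_ \in _); rewrite ?normr1 ?normr0.
have ic : P.-integrable setT (EFin \o cst (eps / 2)).
  exact: finite_measure_integrable_cst.
have iCI : P.-integrable setT (EFin \o (fun w => 2 * C * \1_L w)).
  exact: (integrableZl measurableT (2 * C) iI).
apply: (@le_trans _ _ (\int[P]_w (cst (eps / 2) w + 2 * C * \1_L w))).
  apply: le_Rintegral => //.
  - exact: integrable_norm.
  - exact: (@integrableD _ _ _ P setT measurableT
      (EFin \o cst (eps / 2)) (EFin \o (fun w => 2 * C * \1_L w))).
  - move=> w _ /=; rewrite indicE; have [wL|wL] := boolP (w \in L).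
      rewrite mulr1 (le_trans (ler_normB _ _))//.
      have := fC 0; have := fC (Y n w); lra.
    rewrite mulr0 addr0 hsmall// leNgt; apply/negP => h.
    by move/negP: wL; apply; rewrite inE.
rewrite (RintegralD measurableT ic iCI) (RintegralZl _ measurableT iI).
rewrite (Rintegral_cst P measurableT).
rewrite [X in fine X]probability_setT mulr1.
rewrite /Rintegral (integral_indic P measurableT (mL n)) setIT -/L.
have : (4 * C + 1) * fine (P L) <= eps.
  by rewrite mulrC -ler_pdivlMr.
have : 0 <= fine (P L) by rewrite fine_ge0.
nra.
Qed.

End convergence_to_dirac.

Section trace_space.
Context {R : realType} (I : set R).

(* [B] is measurable as soon as it agrees on [I] with a Borel set; [I] itself
   need not be Borel. *)
Definition trace_sets : set (set R) :=
  [set B | exists2 B', measurable B' & B `&` I = B' `&` I].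

Definition trace_space : measurableType _ := g_sigma_algebraType trace_sets.

Lemma sigma_algebra_trace_sets : sigma_algebra setT trace_sets.
Proof.
split.
- by exists set0.
- move=> B [B' mB' BB']; exists (~` B'); first exact: measurableC.
  rewrite setTD; apply/seteqP; split => x [nB Ix]; split => // h; apply: nB.
    by have : (B' `&` I) x by []; rewrite -BB' => -[].
  by have : (B `&` I) x by []; rewrite BB' => -[].
- move=> F FG.
  have /choice[F' F'P] : forall n, exists B' : set R,
      measurable B' /\ F n `&` I = B' `&` I.
    by move=> n; have [B' ? ?] := FG n; exists B'.
  exists (\bigcup_n F' n); first by apply: bigcupT_measurable => n; have [] := F'P n.
  by rewrite !setI_bigcupl; apply: eq_bigcupr => n _; have [] := F'P n.
Qed.

Lemma trace_measurableE :
  @measurable _ trace_space = trace_sets.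
Proof. exact: measurable_g_measurableTypeE sigma_algebra_trace_sets. Qed.

(** [B'] is chosen before [f]: the same Borel set serves all [I]-valued maps, as is required to
    transfer independence and equality of laws. *)
Lemma trace_preimageE (B : set trace_space) : measurable B ->
  exists2 B' : set R, measurable B' &
    forall T (f : T -> R), (forall w, I (f w)) -> f @^-1` B = f @^-1` B'.
Proof.
rewrite trace_measurableE => -[B' mB' BB']; exists B' => // T f If.
apply/seteqP; split => w /= h.
  by have : (B `&` I) (f w) by []; rewrite BB' => -[].
by have : (B' `&` I) (f w) by []; rewrite -BB' => -[].
Qed.

Lemma measurable_fun_to_trace d (T : measurableType d) (f : T -> R) :
  measurable_fun setT f -> (forall w, I (f w)) ->
  measurable_fun setT (f : T -> trace_space).
Proof.
move=> mf If _ B /trace_preimageE[B' mB' BB'].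
by rewrite BB'//; exact: mf.
Qed.

Lemma trace_measurable_ext (f g : R -> R) :
  {in I, f =1 g} -> measurable_fun setT (f : trace_space -> R) ->
  measurable_fun setT (g : trace_space -> R).
Proof.
move=> fg mf _ B mB; have := mf measurableT B mB.
rewrite trace_measurableE => -[B' mB' fBB']; exists B' => //.
rewrite -fBB'; apply/seteqP; split => x [[_ Bx] Ix]; split => //; split => //=.
  by rewrite fg// inE.
by rewrite -fg// inE.
Qed.

(** On [I], a superlevel set of [f] coincides with its upward closure in the line, which is an
    interval and therefore Borel. *)
Lemma trace_nondecreasing_measurable (f : R -> R) :
  {in I &, {homo f : x y / x <= y}} ->
  measurable_fun setT (f : trace_space -> R).
Proof.
move=> f_nd; apply: (measurability _ (RGenCInfty.measurableE R)).
move=> _ [_ [c ->] <-]; rewrite setTI trace_measurableE.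
exists [set y | exists x, [/\ I x, c <= f x & x <= y]].
  apply: is_interval_measurable => u v [x [Ix cx xu]] _ w /andP[uw _].
  by exists x; split => //; exact: le_trans uw.
apply/seteqP; split => y [/= h Iy]; split => //.
  by exists y; split => //; move: h; rewrite in_itv/= andbT.
case: h => x [Ix cx xy]; rewrite in_itv/= andbT.
by apply: (le_trans cx); apply: f_nd; rewrite ?inE.
Qed.

End trace_space.

(** * Differentiation of the contrast *)

Section derivatives_on_a_set.
Context {R : realType}.
Implicit Types (A : set R) (f df : R -> R).

Lemma cvg_within_dnbhsP A (g : R -> R) (t l : R) :
  g x @[x --> within A t^'] --> l <->
  forall eps : R, 0 < eps -> exists2 del : R, 0 < del &
    forall y, A y -> y != t -> `|y - t| < del -> `|l - g y| < eps.
Proof.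
split.
  move=> /cvgrPdist_lt gl eps eps0; have := gl _ eps0.
  rewrite /within/= /dnbhs/within/= => /nbhs_ballP[del /= del0 h].
  exists del => // y Ay yt ydel; apply: (h y) => //.
  by rewrite /ball/= distrC.
move=> h; apply/cvgrPdist_lt => eps eps0; have [del del0 hd] := h _ eps0.
rewrite /within/= /dnbhs/within/=; apply/nbhs_ballP; exists del => //= y.
rewrite /ball/= distrC => yd yt Ay; exact: hd.
Qed.

Lemma cvg_within_dnbhs_seq A (g : R -> R) (t l : R) (s : nat -> R) :
  g x @[x --> within A t^'] --> l -> s n @[n --> \oo] --> t ->
  (forall n, A (s n)) -> (forall n, s n != t) -> g (s n) @[n --> \oo] --> l.
Proof.
move=> /cvg_within_dnbhsP gl st As snt; apply/cvgrPdist_lt => eps eps0.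
have [del del0 hd] := gl _ eps0.
near=> n; apply: hd => //.
by rewrite distrC; near: n; move/cvgrPdist_lt: st; apply.
Unshelve. all: by end_near. Qed.

Lemma derivable_on_locally_lipschitz A f t l :
  diff_quot f t @ within A t^' --> l ->
  exists2 del : R, 0 < del &
    forall y, A y -> `|y - t| < del -> `|f y - f t| <= (`|l| + 1) * `|y - t|.
Proof.
move=> /cvg_within_dnbhsP/(_ 1 ltr01)[del del0 hd]; exists del => // y Ay ydel.
have [->|yt] := eqVneq y t; first by rewrite !subrr normr0 mulr0.
have yt0 : 0 < `|y - t| by rewrite normr_gt0 subr_eq0.
have := hd y Ay yt ydel; rewrite /diff_quot => h.
rewrite -ler_pdivrMr// -normfV -normrM.
have -> : (f y - f t) / (y - t) = l - (l - (f y - f t) / (y - t)) by rewrite subKr.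
by rewrite (le_trans (ler_normB _ _))// lerD2l ltW.
Qed.

Lemma derivable_on_within_continuous A f df (s t : R) : `[s, t] `<=` A ->
  (forall u, s <= u <= t -> diff_quot f u @ within A u^' --> df u) ->
  {within `[s, t], continuous f}.
Proof.
move=> stA fdf.
apply/subspace_continuousP => u; rewrite /= in_itv/= => uin.
have [del del0 hd] := derivable_on_locally_lipschitz (fdf u uin).
apply/cvgrPdist_lt => eps eps0; rewrite /within/=; apply/nbhs_ballP.
have l0 : 0 < `|df u| + 1 by rewrite ltr_wpDl.
exists (Num.min del (eps / (`|df u| + 1))) => /=.
  by rewrite lt_min del0 divr_gt0.
move=> y; rewrite /ball/= lt_min distrC => /andP[yd ye] yin; rewrite distrC.
apply: le_lt_trans (hd y (stA _ yin) yd) _.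
by rewrite mulrC -ltr_pdivlMr.
Qed.

(** Strictly between [s] and [t], small increments remain in [A], so the relative derivative is the
    usual one there; at the endpoints only continuity is used. *)
Lemma mvt_on A f df (a b : R) : `[a, b] `<=` A ->
  (forall u, a <= u <= b -> diff_quot f u @ within A u^' --> df u) ->
  forall s t, a <= s <= b -> a <= t <= b ->
  exists2 u, a <= u <= b & f t - f s = df u * (t - s).
Proof.
move=> abA fdf.
suff main (s t : R) : s <= t -> a <= s <= b -> a <= t <= b ->
  exists2 u, a <= u <= b & f t - f s = df u * (t - s).
  move=> s t sab tab; have [st|/ltW ts] := leP s t; first exact: main.
  have [u uab e] := main _ _ ts tab sab; exists u => //.
  by rewrite -opprB e -mulrN opprB.
move=> st /andP[a_s sb] /andP[a_t tb].
have inab u : s <= u <= t -> a <= u <= b by lra.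
have inA u : s <= u <= t -> A u by move=> /inab h; apply: abA; rewrite /= in_itv.
have [||c] := @MVT_segment R f df s t st.
- move=> u; rewrite in_itv/= => /andP[su ut].
  have uab : a <= u <= b by apply: inab; rewrite !ltW.
  have /cvg_within_dnbhsP du := fdf u uab.
  have lim : h^-1 *: ((f \o shift u) (h *: 1) - f u) @[h --> 0^'] --> df u.
    apply/cvgrPdist_lt => eps eps0; have [del del0 hd] := du _ eps0.
    rewrite /dnbhs/within/=; apply/nbhs_ballP.
    exists (Num.min del (Num.min (u - s) (t - u))) => /=.
      by rewrite !lt_min del0 !subr_gt0 su ut.
    move=> h; rewrite /ball/= sub0r normrN !lt_min => /and3P[hd1 hs ht] h0.
    have := hd (h + u); rewrite /diff_quot addrK => /(_ _ _ hd1).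
    rewrite [h *: 1]mulr1 [_ *: _]mulrC; apply.
      by move: hs ht; rewrite !ltr_norml => /andP[? ?] /andP[? ?]; apply: inA; lra.
    by rewrite -subr_eq0 addrK.
  apply: DeriveDef; first by apply/cvg_ex; exists (df u).
  exact: cvg_lim lim.
- apply: (@derivable_on_within_continuous A _ df) => [u|u /inab]; last exact: fdf.
  by rewrite /= in_itv/=; exact: inA.
rewrite in_itv/= => cin ->; exists c => //; exact: inab.
Qed.

Lemma derivable_on_cvg A f t : derivable_on A f t ->
  diff_quot f t @ within A t^' --> derive_on A f t.
Proof. by []. Qed.

(** A limit that does not exist defaults to [point], which is [0] here. Thus a nonzero value of
    [M''] certifies that [M'] is differentiable. *)
Lemma derive_on_neq0 A f t : derive_on A f t != 0 -> derivable_on A f t.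
Proof. exact: cvgNpoint. Qed.

(** A sequence in [[a, b]] that tends to [t] without meeting it, coming from [b] when [t = a] and
    from [a] otherwise. It turns limits of difference quotients into limits along a sequence. *)
Definition approach (a b t : R) (k : nat) : R :=
  let c := if t == a then b else a in t + (c - t) * k.+1%:R^-1.

Lemma approach_itv (a b t : R) k : a <= t <= b -> a <= approach a b t k <= b.
Proof.
move=> /andP[at_ tb]; rewrite /approach.
have k0 : 0 <= k.+1%:R^-1 :> R by rewrite invr_ge0.
have k1 : k.+1%:R^-1 <= 1 :> R by rewrite invf_le1// ler1n.
set h := _^-1 in k0 k1 *.
by case: eqP => [->|_]; apply/andP; split; nra.
Qed.

Lemma approach_neq (a b t : R) k : a < b -> approach a b t k != t.
Proof.
move=> ab; rewrite /approach -subr_eq0 addrC addKr mulf_neq0 ?invr_eq0//.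
have [->|ta] := eqVneq t a; first by rewrite subr_eq0 gt_eqF.
by rewrite subr_eq0 eq_sym.
Qed.

Lemma approach_cvg (a b t : R) : approach a b t k @[k --> \oo] --> t.
Proof.
rewrite /approach; set c := if _ then _ else _.
rewrite -[X in _ --> X]addr0 -[X in _ --> _ + X](mulr0 (c - t)).
apply: cvgD; first exact: cvg_cst.
by apply: cvgMr; exact: cvg_harmonic.
Qed.

End derivatives_on_a_set.

(** Precomposing with the projection extends a function continuous on [[a, b]] to the whole line,
    where the results on Caratheodory functions apply. *)
Lemma continuous_comp_clip {R : realType} (a b : R) (f : R -> R) : a <= b ->
  {within `[a, b], continuous f} -> continuous (f \o clip a b).
Proof.
move=> ab /subspace_continuousP cf t.
have := cf (clip a b t); rewrite /= in_itv/= => /(_ (clip_itv _ ab)).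
move=> /cvgrPdist_lt h; apply/cvgrPdist_lt => eps eps0.
have hh := clip_continuous ab (h _ eps0).
apply: (@filterS _ (nbhs t) _ _ _ _ hh) => y /= hy.
by apply: hy; rewrite in_itv/=; exact: clip_itv.
Qed.

(** * The contrast [E |q t| ^ 2] and its drift, for a residual [q] vanishing at [theta] *)

Section quadratic_contrast.
Context {R : realType} d dE {T : measurableType d} {E : measurableType dE}.
Variables (P : probability T R) (e : T -> E).
Hypothesis me : measurable_fun setT e.
Variables (Theta : set R) (a b theta : R) (q dq : R -> E -> R).
Hypothesis ab : a < b.
Hypothesis theta_ab : a < theta < b.
Hypothesis abTheta : `[a, b] `<=` Theta.
Hypothesis mq : forall t, a <= t <= b -> measurable_fun setT (q t).
Hypothesis dqP : forall x t, a <= t <= b ->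
  diff_quot (q ^~ x) t @ within Theta t^' --> dq t x.
Hypothesis cdq : forall x, {within `[a, b], continuous (dq ^~ x)}.
Hypothesis q_theta : forall x, q theta x = 0.

Let S4 (x : E) : \bar R := ereal_sup [set (`|dq t x| ^+ 4)%:E | t in `[a, b]].
Hypothesis S4_int : (\int[P]_w S4 (e w) < +oo)%E.

Let C := 4 * fine (\int[P]_w S4 (e w))%E.
(** On [[a, b]] this is the derivative in [t] of [q t x ^ 2], so that [m] is the candidate for
    [M']. *)
Let H t x := 2 * dq (clip a b t) x * q (clip a b t) x.
Let m t := \int[P]_w H t (e w).

Let theta_in : a <= theta <= b.
Proof. by case/andP: theta_ab => /ltW -> /ltW ->. Qed.

Let cdqc x : continuous (fun t => dq (clip a b t) x).
Proof. exact: (@continuous_comp_clip _ a b (dq ^~ x) (ltW ab) (@cdq x)). Qed.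

Let cdq4 x : continuous (fun t => `|dq (clip a b t) x| ^+ 4).
Proof.
move=> t.
apply: (@continuous_comp _ _ _ (fun t => dq (clip a b t) x)
  (fun y : R => `|y| ^+ 4)); first exact: cdqc.
apply: (@continuous_comp _ _ _ (fun y : R => `|y|) (fun y : R => y ^+ 4)).
  exact: norm_continuous.
exact: exprn_continuous.
Qed.

Let cqc x : continuous (fun t => q (clip a b t) x).
Proof.
apply: (@continuous_comp_clip _ a b (q ^~ x) (ltW ab)).
by apply: (@derivable_on_within_continuous _ Theta _ (dq ^~ x)) => // u; exact: dqP.
Qed.

Let q_mvt x s t : a <= s <= b -> a <= t <= b ->
  exists2 u, a <= u <= b & q t x - q s x = dq u x * (t - s).
Proof.
exact: (@mvt_on _ Theta (q ^~ x) (dq ^~ x) a b abTheta (fun u => @dqP x u)).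
Qed.

(** A pointwise limit of difference quotients along [approach], each of them measurable. *)
Let mdq t : a <= t <= b -> measurable_fun setT (dq t).
Proof.
move=> tab.
apply: (@measurable_fun_cvg _ _ _ _
  (fun k x => diff_quot (q ^~ x) t (approach a b t k))).
  move=> k; rewrite /diff_quot; apply: measurable_funM => //.
  by apply: measurable_funB; apply: mq => //; exact: approach_itv.
move=> x _.
apply: (@cvg_within_dnbhs_seq _ Theta (diff_quot (q ^~ x) t) t _
  (approach a b t) (@dqP x t tab)).
- exact: approach_cvg.
- by move=> n; apply: abTheta; rewrite /= in_itv/= approach_itv.
- by move=> n; exact: approach_neq.
Qed.

Let mH t : measurable_fun setT (H t).
Proof.
have tab := clip_itv t (ltW ab).
apply: measurable_funM; last exact: mq.
by apply: measurable_funM => //; exact: mdq.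
Qed.

Let cH x : continuous (H ^~ x).
Proof.
move=> t; apply: cvgM; last exact: cqc.
by apply: cvgM; [exact: cvg_cst|exact: cdqc].
Qed.

Let S4E x : S4 x = ereal_sup (range (fun t => (`|dq (clip a b t) x| ^+ 4)%:E)).
Proof.
congr ereal_sup; apply/seteqP; split => [y [t]|y [t _ <-]].
  by rewrite /= in_itv/= => tab <-; exists t => //; rewrite clip_id.
by exists (clip a b t) => //=; rewrite in_itv/= clip_itv// ltW.
Qed.

Let mS4 : measurable_fun setT S4.
Proof.
rewrite (funext S4E).
apply: (@ereal_sup_caratheodory_measurable _ _ _
  (fun t x => `|dq (clip a b t) x| ^+ 4)).
  move=> t; apply: measurable_funX; apply: measurableT_comp => //.
  by apply: mdq; rewrite clip_itv// ltW.
by move=> x; exact: cdq4.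
Qed.

Let S4_ge t x : a <= t <= b -> ((`|dq t x| ^+ 4)%:E <= S4 x)%E.
Proof.
by move=> tab; apply: ereal_sup_ubound; exists t => //=; rewrite in_itv.
Qed.

Let S4_ge0 x : (0 <= S4 x)%E.
Proof.
by apply: le_trans (S4_ge x theta_in); rewrite lee_fin exprn_ge0.
Qed.

Let S4_fin x : S4 x \is a fin_num.
Proof.
have [|c cab hc] := @EVT_max R (fun t => `|dq (clip a b t) x| ^+ 4) a b (ltW ab).
  exact: continuous_subspaceT (@cdq4 x).
rewrite ge0_fin_numE// (@le_lt_trans _ _ (`|dq (clip a b c) x| ^+ 4)%:E) ?ltry//.
apply: ub_ereal_sup => _ [t tab <-]; rewrite lee_fin.
by have := hc t tab; rewrite (@clip_id _ a b t).
Qed.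

Let s4 x := fine (S4 x).

Let s4_ge0 x : 0 <= s4 x.
Proof. by rewrite fine_ge0. Qed.

Let dq4_le t x : a <= t <= b -> dq t x ^+ 4 <= s4 x.
Proof.
move=> tab; rewrite -lee_fin /s4 fineK//; apply: le_trans (S4_ge x tab).
by rewrite lee_fin -[4%N]/(2 * 2)%N !exprM real_normK ?num_real.
Qed.

Let dq2M_le s t x : a <= s <= b -> a <= t <= b ->
  dq s x ^+ 2 * dq t x ^+ 2 <= s4 x.
Proof.
move=> sab tab; have := dq4_le x sab; have := dq4_le x tab.
rewrite -[4%N]/(2 * 2)%N !exprM.
have := sqr_ge0 (dq s x ^+ 2 - dq t x ^+ 2).
set u := dq s x ^+ 2; set v := dq t x ^+ 2; rewrite !expr2; lra.
Qed.

Let dqM_le s t x : a <= s <= b -> a <= t <= b ->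
  `|dq s x * dq t x| <= 1 + s4 x.
Proof.
move=> sab tab; have := dq2M_le x sab tab; rewrite -exprMn.
set u := _ * _ => h; rewrite ler_norml; have := s4_ge0 x; nra.
Qed.

(** The source of the multiplicative noise: the residual vanishes at [theta], so the mean value
    theorem yields a factor [t - theta]. *)
Let q_le t x : a <= t <= b -> exists2 u, a <= u <= b &
  q t x = dq u x * (t - theta).
Proof.
by move=> tab; have [u uab] := q_mvt x theta_in tab; rewrite q_theta subr0; exists u.
Qed.

Let int_s4 : P.-integrable setT (EFin \o (fun w => s4 (e w))).
Proof.
have E4 : EFin \o (fun w => s4 (e w)) = S4 \o e.
  by apply/funext => w /=; rewrite /s4 fineK.
rewrite E4; apply/integrableP; split; first exact: measurableT_comp.
by under eq_integral do rewrite /= gee0_abs//.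
Qed.

Let int_D k : P.-integrable setT (EFin \o (fun w => k * (1 + s4 (e w)))).
Proof.
apply: (@integrableZl _ _ _ P setT measurableT k
  (EFin \o (fun w => 1 + s4 (e w)))).
apply: (@integrableD _ _ _ P setT measurableT (EFin \o cst 1)
  (EFin \o (fun w => s4 (e w)))) => //.
exact: finite_measure_integrable_cst.
Qed.

Let CE : C = 4 * \int[P]_w s4 (e w).
Proof.
rewrite /C /Rintegral; congr (4 * fine _); apply: eq_integral => w _.
by rewrite /s4 fineK.
Qed.

(** With [q t = dq u * (t - theta)], [H ^ 2] is [4 * (t - theta) ^ 2] times two squared derivatives,
    whose product is at most the supremum of fourth powers. This is where the [4] in the constant
    comes from. *)
Let H2_bound t x : a <= t <= b -> H t x ^+ 2 <= 4 * (t - theta) ^+ 2 * s4 x.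
Proof.
move=> tab; rewrite /H clip_id//; have [u uab ->] := q_le x tab.
have := dq2M_le x tab uab.
set p := dq t x; set r := dq u x; set s := s4 x; set y := t - theta => h.
have -> : (2 * p * (r * y)) ^+ 2 = 4 * y ^+ 2 * (p ^+ 2 * r ^+ 2) by ring.
by rewrite ler_wpM2l// mulr_ge0// sqr_ge0.
Qed.

Let mHe t : measurable_fun setT (fun w => H t (e w)).
Proof. exact: measurableT_comp. Qed.

Let int_H2 t : a <= t <= b ->
  P.-integrable setT (EFin \o (fun w => H t (e w) ^+ 2)).
Proof.
move=> tab.
apply: (@le_integrable _ _ _ _ _ measurableT _
  (EFin \o (fun w => 4 * (t - theta) ^+ 2 * s4 (e w)))).
- by apply/measurable_EFinP; exact: measurable_funX.
- move=> w _ /=; rewrite lee_fin ger0_norm ?sqr_ge0//.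
  by rewrite (le_trans (H2_bound _ tab))// ler_norm.
- exact: (integrableZl measurableT _ int_s4).
Qed.

Let H2_le t : a <= t <= b ->
  \int[P]_w H t (e w) ^+ 2 <= C * (t - theta) ^+ 2.
Proof.
move=> tab; rewrite CE mulrAC -RintegralZl//.
apply: le_Rintegral => //; first exact: int_H2.
  exact: (integrableZl measurableT _ int_s4).
by move=> w _; exact: H2_bound.
Qed.

Let H_bound t x : `|H t x| <= 2 * (b - a) * (1 + s4 x).
Proof.
have tab := clip_itv t (ltW ab).
rewrite /H; have [u uab ->] := q_le x tab.
set c := clip a b t in tab *.
have -> : 2 * dq c x * (dq u x * (c - theta)) =
  2 * ((c - theta) * (dq c x * dq u x)) by ring.
rewrite normrM ger0_norm// -mulrA ler_wpM2l// normrM ler_pM//.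
  rewrite ler_norml.
  by case/andP: tab => ? ?; case/andP: theta_in => ? ?; apply/andP; split; lra.
exact: dqM_le.
Qed.

Let int_H t : P.-integrable setT (EFin \o (fun w => H t (e w))).
Proof.
apply: (@le_integrable _ _ _ _ _ measurableT _
  (EFin \o (fun w => 2 * (b - a) * (1 + s4 (e w))))).
- exact/measurable_EFinP.
- by move=> w _ /=; rewrite lee_fin (le_trans (H_bound _ _))// ler_norm.
- exact: int_D.
Qed.

(** Dominated convergence: thanks to the clipping, [H_bound] is uniform over the whole line. *)
Lemma quadratic_contrast_drift_continuous : continuous m.
Proof.
move=> t.
have tin : t \in `]t - 1, t + 1[%classic.
  by rewrite inE /= in_itv/=; apply/andP; split; lra.
apply: (@continuity_under_integral R _ _ P (fun s w => H s (e w)) setT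
  measurableT (t - 1) (t + 1) _ _
  (fun w => 2 * (b - a) * (1 + s4 (e w))) _ _ t tin) => //.
- by apply: (aeW P) => w _ s _; exact: cH.
- by move=> s _; apply: (aeW P) => w _; exact: H_bound.
Qed.

Variable M : R -> R.
Hypothesis ME : forall t, a <= t <= b ->
  M t = fine (\int[P]_w ((`|q t (e w)| ^+ 2)%R)%:E)%E.

Let int_q2 t : a <= t <= b ->
  P.-integrable setT (EFin \o (fun w => `|q t (e w)| ^+ 2)).
Proof.
move=> tab.
apply: (@le_integrable _ _ _ _ _ measurableT _
  (EFin \o (fun w => (b - a) ^+ 2 * (1 + s4 (e w))))).
- apply/measurable_EFinP; apply: measurable_funX.
  by apply: measurableT_comp => //; apply: measurableT_comp => //; exact: mq.
- move=> w _ /=; rewrite lee_fin ger0_norm ?sqr_ge0//.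
  apply: le_trans (ler_norm _); rewrite real_normK ?num_real//.
  have [u uab ->] := q_le (e w) tab; rewrite exprMn mulrC ler_pM ?sqr_ge0//.
    by case/andP: tab => ? ?; case/andP: theta_in => ? ?; nra.
  have := dqM_le (e w) uab uab.
  by rewrite -expr2 ger0_norm ?sqr_ge0.
- exact: int_D.
Qed.

(** The dominating function for differentiation under the integral: factor the difference of squares
    and apply the mean value theorem to each factor. *)
Let q2_quot s t x : a <= s <= b -> a <= t <= b -> s != t ->
  `|(`|q s x| ^+ 2 - `|q t x| ^+ 2) / (s - t)| <= 2 * (b - a) * (1 + s4 x).
Proof.
move=> sab tab st; rewrite !real_normK ?num_real// subr_sqr.
have [u uab ->] := q_mvt x tab sab.
have [v vab ->] := q_le x sab; have [r rab ->] := q_le x tab.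
have -> : dq u x * (s - t) * (dq v x * (s - theta) + dq r x * (t - theta)) /
  (s - t) = dq u x * dq v x * (s - theta) + dq u x * dq r x * (t - theta).
  by field; rewrite subr_eq0.
have bd c y : a <= y <= b -> a <= c <= b ->
    `|dq u x * dq c x * (y - theta)| <= (b - a) * (1 + s4 x).
  move=> yab cab; rewrite normrM mulrC ler_pM//; last exact: dqM_le.
  rewrite ler_norml.
  by case/andP: yab => ? ?; case/andP: theta_in => ? ?; apply/andP; split; lra.
have := bd v s sab vab; have := bd r t tab rab => h1 h2.
rewrite (le_trans (ler_normD _ _))//; lra.
Qed.

(** The limit of the difference quotient exists by assumption, so it is enough to identify it along
    one sequence, by dominated convergence. *)
Lemma derive_quadratic_contrast t : a <= t <= b -> derivable_on Theta M t ->
  derive_on Theta M t = m t.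
Proof.
move=> tab dM.
pose s := approach a b t.
have sab k : a <= s k <= b by exact: approach_itv.
have st k : s k != t by exact: approach_neq.
have sTheta k : Theta (s k) by apply: abTheta; rewrite /= in_itv/=.
have lim1 : diff_quot M t (s k) @[k --> \oo] --> derive_on Theta M t.
  apply: (cvg_within_dnbhs_seq dM) => //; exact: approach_cvg.
suff lim2 : diff_quot M t (s k) @[k --> \oo] --> m t.
  exact: (cvg_unique _ lim1 lim2).
pose F k w := (`|q (s k) (e w)| ^+ 2 - `|q t (e w)| ^+ 2) / (s k - t).
have intF k : P.-integrable setT (EFin \o F k).
  rewrite (_ : _ \o _ = EFin \o (fun w => (s k - t)^-1 *
    (`|q (s k) (e w)| ^+ 2 - `|q t (e w)| ^+ 2))); last first.
    by apply/funext => w /=; rewrite /F mulrC.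
  apply: (@integrableZl _ _ _ P setT measurableT (s k - t)^-1
    (EFin \o (fun w => `|q (s k) (e w)| ^+ 2 - `|q t (e w)| ^+ 2))).
  apply: (@integrableB _ _ _ P setT measurableT
    (EFin \o (fun w => `|q (s k) (e w)| ^+ 2))
    (EFin \o (fun w => `|q t (e w)| ^+ 2))); exact: int_q2.
have -> : (fun k => diff_quot M t (s k)) = fun k => \int[P]_w F k w.
  apply/funext => k; rewrite /diff_quot !ME// /F.
  rewrite -(RintegralB measurableT (int_q2 (sab k)) (int_q2 tab)) mulrC.
  rewrite -RintegralZl//; first by apply: eq_Rintegral => w _; rewrite mulrC.
  apply: (@integrableB _ _ _ P setT measurableT
    (EFin \o (fun w => `|q (s k) (e w)| ^+ 2))
    (EFin \o (fun w => `|q t (e w)| ^+ 2))); exact: int_q2.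
apply: fine_cvg; rewrite fineK; last exact: integrable_fin_num (int_H t).
apply: (@dominated_cvg _ _ _ P setT measurableT (fun k w => (F k w)%:E) _
  (EFin \o (fun w => 2 * (b - a) * (1 + s4 (e w))))) => //.
- by move=> k; exact: measurable_int (intF k).
- move=> w _; apply: cvg_EFin; first exact: nearW.
  rewrite /H clip_id//.
  have FE : F ^~ w = fun k => diff_quot (q ^~ (e w)) t (s k) *
    (q (s k) (e w) + q t (e w)).
    apply/funext => k; rewrite /F !real_normK ?num_real// subr_sqr /diff_quot.
    by rewrite mulrAC.
  rewrite (_ : fine \o _ = F ^~ w)// FE.
  rewrite (_ : 2 * _ * _ = dq t (e w) * (q t (e w) + q t (e w))); last by ring.
  apply: cvgM.
    by apply: (cvg_within_dnbhs_seq (@dqP (e w) t tab)) => //; exact: approach_cvg.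
  apply: cvgD; last exact: cvg_cst.
  have := @cqc (e w) t; rewrite /continuous_at /= clip_id// => qt.
  have := cvg_comp _ _ (@approach_cvg _ a b t) qt.
  rewrite (_ : _ \o _ = fun k => q (s k) (e w))//.
  by apply/funext => k /=; rewrite clip_id//; exact: sab.
- by move=> k w _; rewrite lee_fin; exact: q2_quot.
Qed.

Hypothesis M_sep : forall t, a <= t <= b -> t != theta ->
  0 < (t - theta) * derive_on Theta M t.

Let m_theta : m theta = 0.
Proof.
rewrite /m /H (clip_id theta_in).
under eq_Rintegral do rewrite q_theta mulr0.
by rewrite /Rintegral integral0.
Qed.

(* Where [M] failed to be differentiable, [derive_on] would be [point = 0],
   against [M_sep]; at [theta] both values agree anyway. *)
Let dME t : a <= t <= b -> derive_on Theta M t = m t.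
Proof.
move=> tab.
have [dM|ndM] := pselect (derivable_on Theta M t).
  exact: derive_quadratic_contrast.
have d0 : derive_on Theta M t = 0 by rewrite /derive_on dvgP.
have [tE|tt] := eqVneq t theta; first by rewrite d0 tE m_theta.
by have := M_sep tab tt; rewrite d0 mulr0 ltxx.
Qed.

(** The lower bound makes [M''] nonzero, so [M'] is differentiable on [[a, b]]; the mean value
    theorem between [theta] and [t] gives [M' t = M'' u * (t - theta)]. *)
Lemma quadratic_contrast_drift_half :
  (forall t, a <= t <= b -> 1 / 2 <= derive_on Theta (derive_on Theta M) t) ->
  forall t, a <= t <= b -> 2^-1 * (t - theta) ^+ 2 <= (t - theta) * m t.
Proof.
move=> M2 t tab.
have dd u : a <= u <= b ->
    diff_quot (derive_on Theta M) u @ within Theta u^' -->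
    derive_on Theta (derive_on Theta M) u.
  move=> uab; apply/derivable_on_cvg/derive_on_neq0.
  by rewrite gt_eqF// (lt_le_trans _ (M2 u uab)).
have [u uab] := mvt_on abTheta dd theta_in tab.
rewrite !dME// m_theta subr0 => ->; rewrite [leRHS]mulrCA -expr2.
by rewrite ler_wpM2r ?sqr_ge0//; have := M2 u uab; rewrite div1r.
Qed.

Lemma quadratic_contrast_drift_local :
  1 / 2 < derive_on Theta (derive_on Theta M) theta ->
  exists c del : R, [/\ 1 < 2 * c, 0 < del & forall t, a <= t <= b ->
    `|t - theta| < del -> c * (t - theta) ^+ 2 <= (t - theta) * m t].
Proof.
set L := derive_on _ _ _ => L2.
have := @derivable_on_cvg _ Theta (derive_on Theta M) theta.
have Ln0 : L != 0 by rewrite gt_eqF// (lt_trans _ L2).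
move=> /(_ (derive_on_neq0 Ln0))/cvg_within_dnbhsP/(_ ((L - 1/2) / 2)).
have eps0 : 0 < (L - 1 / 2) / 2 by lra.
move=> /(_ eps0)[del del0 hd].
(* The midpoint of [1/2] and [L = M'' theta]: near [theta] the quotient [m t / (t - theta)] differs
   from [L] by less than half the gap. *)
exists ((L + 1 / 2) / 2), del; split => //; first lra.
move=> t tab td; have [->|tt] := eqVneq t theta.
  by rewrite subrr expr0n mulr0 mul0r.
have := hd t; rewrite /diff_quot !dME// m_theta subr0 => /(_ _ tt td) h.
have : `|L - m t / (t - theta)| < (L - 1 / 2) / 2.
  by apply: h; apply: abTheta; rewrite /= in_itv.
rewrite ltr_norml => /andP[_ h2].
have -> : (t - theta) * m t = m t / (t - theta) * (t - theta) ^+ 2.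
  by field; rewrite subr_eq0.
rewrite ler_wpM2r ?sqr_ge0//; move: h2.
by rewrite -/L; move: (m t / _) => r; lra.
Qed.

(** Adding to [(t - theta) * m t] a bump supported in the [del]-neighbourhood of [theta] makes it
    positive on all of [[a, b]]. Its minimum bounds the drift outside that neighbourhood; inside,
    the local bound applies. *)
Lemma quadratic_contrast_drift_global :
  1 / 2 < derive_on Theta (derive_on Theta M) theta ->
  exists2 c : R, 0 < c &
    forall t, a <= t <= b -> c * (t - theta) ^+ 2 <= (t - theta) * m t.
Proof.
move=> /quadratic_contrast_drift_local[c [del [c1 del0 hloc]]].
pose h t := (t - theta) * m t + clip 0 del (del - `|t - theta|).
have ch : {within `[a, b], continuous h}.
  apply: continuous_subspaceT => t; apply: cvgD.
    apply: cvgM; last exact: quadratic_contrast_drift_continuous.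
    by apply: cvgB; [exact: cvg_id|exact: cvg_cst].
  apply: (@continuous_comp _ _ _ (fun t : R => del - `|t - theta|) (clip 0 del)).
    apply: cvgB; first exact: cvg_cst.
    apply: cvg_norm.
    by apply: cvgB; [exact: cvg_id|exact: cvg_cst].
  by apply: clip_continuous; exact: ltW.
have [t0] := EVT_min (ltW ab) ch; rewrite in_itv/= => t0ab hmin.
have clip_ge0 x : 0 <= clip 0 del x by have /andP[] := clip_itv x (ltW del0).
have mu0 : 0 < h t0.
  have [->|t0t] := eqVneq t0 theta.
    rewrite /h subrr mul0r add0r normr0 subr0 clip_id// lexx andbT.
    exact: ltW.
  by rewrite /h ltr_pwDl// -dME// M_sep.
have ba : 0 < (b - a) ^+ 2 by rewrite exprn_gt0// subr_gt0.
exists (Num.min c (h t0 / (b - a) ^+ 2)).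
  by rewrite lt_min divr_gt0// andbT; lra.
move=> t tab; have [td|td] := ltP `|t - theta| del.
  by apply: le_trans (hloc t tab td); rewrite ler_wpM2r ?sqr_ge0// ge_min lexx.
apply: (@le_trans _ _ (h t0 / (b - a) ^+ 2 * (t - theta) ^+ 2)).
  by rewrite ler_wpM2r ?sqr_ge0// ge_min lexx orbT.
apply: (@le_trans _ _ (h t0)).
  rewrite mulrAC ler_pdivrMr// ler_wpM2l ?(ltW mu0)//.
  by case/andP: tab => ? ?; case/andP: theta_in => ? ?; nra.
have : t \in `[a, b] by rewrite in_itv.
move=> /hmin; rewrite [h t]/h.
have -> : clip 0 del (del - `|t - theta|) = 0 by rewrite /clip subr_le0 td.
by rewrite addr0.
Qed.

Variables (Z : nat -> T -> E) (theta0 : R).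
Hypothesis mZ : forall n, measurable_fun setT (Z n).
Hypothesis iid : iid_innovations Z P e.
Hypothesis theta0_ab : a <= theta0 <= b.

Let C_ge0 : 0 <= C.
Proof. by rewrite CE mulr_ge0// Rintegral_ge0. Qed.

Lemma quadratic_contrast_prm_probability (eta : R) :
  1 / 2 < derive_on Theta (derive_on Theta M) theta -> 0 < eta ->
  fine (P [set w | eta < n%:R * (prm Z a b theta0 H n w - theta) ^+ 2])
    @[n --> \oo] --> 0.
Proof.
move=> M2 eta0.
have [c0 c0_gt0 hglob] := quadratic_contrast_drift_global M2.
have [c [del [c1 del0 hloc]]] := quadratic_contrast_drift_local M2.
(* The localisation uses a non-strict bound on the squared distance, while the local drift asks for
   [|t - theta| < del]; hence the threshold [(del / 2) ^ 2]. *)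
apply: (@prm_cvg_probability _ _ _ _ _ P Z e mZ me iid a b theta theta0 C H
  theta_in theta0_ab mH cH int_H2 H2_le c0 c ((del / 2) ^+ 2)) => //.
  by rewrite exprn_gt0// divr_gt0.
move=> t tab tdel; apply: hloc => //.
have : `|t - theta| <= del / 2.
  by rewrite -ler_sqr ?nnegrE ?real_normK ?num_real// ltW// divr_gt0.
by move=> h; apply: (le_lt_trans h); lra.
Qed.

Lemma measurable_quadratic_contrast_prm n :
  measurable_fun setT (prm Z a b theta0 H n).
Proof.
exact: (@measurable_prm _ _ _ _ _ Z mZ a b theta theta0 H theta_in mH cH).
Qed.

Lemma quadratic_contrast_prm_rate :
  (forall t, a <= t <= b -> 1 / 2 <= derive_on Theta (derive_on Theta M) t) ->
  forall n, (\int[P]_w ((prm Z a b theta0 H n w - theta) ^+ 2)%:E <=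
    ((theta0 - theta) ^+ 2 * (expR (C * pi ^+ 2 / 6) / n.+1%:R))%:E)%E.
Proof.
move=> /quadratic_contrast_drift_half hm n.
have intV := @integrable_prm_sqr _ _ _ _ _ P Z mZ a b theta theta0 H
  theta_in theta0_ab mH cH n setT measurableT.
rewrite -[leLHS]fineK; last exact: integrable_fin_num intV.
rewrite lee_fin.
exact: (@prm_rate _ _ _ _ _ P Z e mZ me iid a b theta theta0 C H
  theta_in theta0_ab mH cH int_H2 H2_le C_ge0 hm).
Qed.

End quadratic_contrast.

(** * Inverses of the increasing family *)

(** All innovations take values in [I], so each trace-measurable set can be replaced by a Borel
    representative; the product rule for the indices up to [n] and up to [n + 1] then gives the
    claim. *)
Lemma independent_seq_trace {R : realType} d {T : measurableType d}
    (P : probability T R) (I : set R) (eps : nat -> {RV P >-> R})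
    (e : {RV P >-> R}) :
  (forall n w, I (eps n w)) -> (forall w, I (e w)) ->
  independent_seq eps -> (forall n, same_law (eps n) e) ->
  iid_innovations (fun n => eps n : T -> trace_space I) P (e : T -> trace_space I).
Proof.
move=> epsI eI indep law n B C mB mC.
have /choice[B' B'P] : forall i, exists B' : set R, measurable B' /\
    forall f : T -> R, (forall w, I (f w)) -> f @^-1` B i = f @^-1` B'.
  by move=> i; have [B' ? h] := trace_preimageE (mB i); exists B'; split => // f; exact: h.
have [C' mC' C'P] := trace_preimageE mC.
pose D i := if i == n.+1 then C' else B' i.
have mD i : measurable (D i).
  by rewrite /D; case: ifP => // _; have [] := B'P i.
have bigE : \bigcap_(i in `I_n.+1) ((eps i : T -> trace_space I) @^-1` B i) =
    \bigcap_(i in [set` iota 0 n.+1]) (eps i @^-1` D i).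
  rewrite (_ : [set` iota 0 n.+1] = `I_n.+1); last first.
    have memE i : (i \in iota 0 n.+1) = (i < n.+1)%N by rewrite mem_iota.
    apply/seteqP; split => i hi; first by rewrite /mkset -memE.
    by suff : i \in iota 0 n.+1 by []; rewrite memE.
  apply: eq_bigcapr => i /= ni; rewrite /D ltn_eqF//.
  by have [_] := B'P i; apply; exact: epsI.
rewrite bigE (C'P _ (eps n.+1) (epsI n.+1)) (C'P _ e eI).
have := indep (iota 0 n.+2) D (iota_uniq _ _) mD.
have iotaE : iota 0 n.+2 = iota 0 n.+1 ++ [:: n.+1].
  by rewrite -[X in iota 0 X]addn1 iotaD.
rewrite iotaE big_cat big_seq1 -(indep (iota 0 n.+1) D (iota_uniq _ _) mD).
have DE : D n.+1 = C' by rewrite /D eqxx.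
rewrite DE (law n.+1 _ mC') => <-; congr (P _).
have memE i : (i \in iota 0 n.+1 ++ [:: n.+1]) =
    (i \in iota 0 n.+1) || (i == n.+1) by rewrite mem_cat mem_seq1.
apply/seteqP; split => [w [h1 h2] i hi|w h].
  have : i \in iota 0 n.+1 ++ [:: n.+1] by [].
  by rewrite memE => /orP[/h1//|/eqP ->]; rewrite DE.
split=> [i ni|]; first by apply: h; rewrite /mkset memE; apply/orP; left.
by rewrite -DE; apply: h; rewrite /mkset memE eqxx orbT.
Qed.

Section phi_inverse.
Context {R : realType}.
Variables (I1 I2 : set R) (phi : R -> R -> R) (s t : R).
Hypothesis bij_s : set_bij I1 I2 (phi s).
Hypothesis bij_t : set_bij I1 I2 (phi t).
Hypothesis inc_s : {in I1 &, {homo phi s : x y / x < y}}.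
Hypothesis inc_t : {in I1 &, {homo phi t : x y / x < y}}.

Lemma phi_invK x : I1 x -> phi_inv I1 phi s (phi s x) = x.
Proof.
move=> Ix; have [_ inj_s _] := bij_s.
by rewrite /phi_inv pinvKV ?inE.
Qed.

(** If the order of two inverses were reversed, applying the increasing [phi t] would reverse that
    of [phi s x] and [phi s y]. Monotonicity is what makes the residual measurable on
    [trace_space I1]. *)
Lemma phi_inv_nondecreasing :
  {in I1 &, {homo (fun x => phi_inv I1 phi t (phi s x)) : x y / x <= y}}.
Proof.
have [fun_s _ _] := bij_s; have [_ _ surj_t] := bij_t.
have inv x : I1 x ->
    I1 (phi_inv I1 phi t (phi s x)) /\ phi t (phi_inv I1 phi t (phi s x)) = phi s x.
  move=> Ix; split.
    by apply: (surjpinv_image_sub surj_t); exists (phi s x) => //; exact: fun_s.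
  by rewrite /phi_inv pinvK// inE; apply: surj_t; exact: fun_s.
move=> x y /set_mem Ix /set_mem Iy xy; rewrite leNgt; apply/negP => yx.
have [Ipx ex] := inv x Ix; have [Ipy ey] := inv y Iy.
have := inc_t (mem_set Ipy) (mem_set Ipx) yx; rewrite ex ey.
move: xy; rewrite le_eqVlt => /predU1P[->|xy]; first by rewrite ltxx.
by rewrite ltNge ltW// inc_s// inE.
Qed.

End phi_inverse.

(** * Application to the family of inverses *)

Theorem theorem3p2 (d : measure_display) (T : measurableType d) (R : realType)
  (P : probability T R)
  (Theta I1 I2 : set R) (phi : R -> R -> R) (theta : R)
  (eps : nat -> {RV P >-> R}) (e : {RV P >-> R})
  (Theta_itv : is_interval Theta)
  (theta_in : Theta theta)
  (eps_I1 : forall n w, I1 (eps n w))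
  (e_I1 : forall w, I1 (e w))
  (eps_indep : independent_seq eps)
  (eps_law : forall n, same_law (eps n) e)
  (X := fun (n : nat) (w : T) => phi theta (eps n w))
  (M := contrast P I1 phi theta e)
  (M' := derive_on Theta M)
  (M'' := derive_on Theta M')
  (dpsi := fun (t : R) (w : T) => dphi_inv Theta I1 phi t (phi theta (e w)))
  (d2psi := fun (t : R) (w : T) => d2phi_inv Theta I1 phi t (phi theta (e w)))
  (h_bij : forall t, Theta t -> set_bij I1 I2 (phi t) /\
    {in I1 &, {homo phi t : x y / x < y}})
  (h_C1 : forall x, I2 x ->
    continuously_differentiable_on Theta (fun t => phi_inv I1 phi t x))
  (h_L2 : forall t, Theta t ->
    ('E_P[fun w => (`|phi_inv I1 phi t (phi theta (e w))| ^+ 2)%R] < +oo)%E)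
  (h_L4 : forall B, compact B -> B `<=` Theta ->
    (expect_sup P B (fun t w => (`|dpsi t w| ^+ 4)%R) < +oo)%E)
  (a b : R) (a_lt_b : a < b)
  (ab_Theta : `[a, b] `<=` Theta)
  (theta_ab : theta \in `]a, b[)
  (h_sep : forall t, t \in `[a, b] -> t != theta -> 0 < (t - theta) * M' t)
  (h_D2 : forall x, I2 x ->
    twice_differentiable_on Theta (fun t => phi_inv I1 phi t x))
  (h_D2_L2 : forall B, compact B -> B `<=` Theta ->
    (expect_sup P B (fun t w => (`|d2psi t w| ^+ 2)%R) < +oo)%E)
  (h_M2 : 1 / 2 < M'' theta)
  (h_alpha : exists2 alpha : R, 4 < alpha &
    forall B, compact B -> B `<=` Theta ->
      (expect_sup P B (fun t w => (`|dpsi t w| `^ alpha)%R) < +oo)%E)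
  (theta0 : R) (theta0_ab : theta0 \in `[a, b])
  (gamma := fun n : nat => (1 / n%:R : R))
  (theta_hat := robbins_monro Theta I1 phi a b gamma eps X theta0)
  (C1 := 4 * fine (expect_sup P `[a, b] (fun t w => (`|dpsi t w| ^+ 4)%R))) :
  cvg_in_distribution P
    (fun n w => Num.sqrt n%:R * (theta_hat n w - theta)) \d_(0 : R) /\
  ((forall t, t \in `[a, b] -> 1 / 2 <= M'' t) ->
   forall n : nat,
     ('E_P[fun w => ((theta_hat n w - theta) ^+ 2)%R] <=
      ((theta0 - theta) ^+ 2 * (expR (C1 * pi ^+ 2 / 6) / n.+1%:R))%:E)%E).

Proof.
have ab := a_lt_b.
have th_oo : a < theta < b by move: theta_ab; rewrite in_itv.
have th_cc : a <= theta <= b by case/andP: th_oo => /ltW -> /ltW ->.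
have th0 : a <= theta0 <= b by move: theta0_ab; rewrite in_itv.
have inTheta t : a <= t <= b -> Theta t.
  by move=> tab; apply: ab_Theta; rewrite /= in_itv.
have [bij_th inc_th] := h_bij theta theta_in.
have [fun_th _ _] := bij_th.
pose E := trace_space I1.
pose Z n : T -> E := eps n.
pose eE : T -> E := e.
have mZ n : measurable_fun setT (Z n).
  by apply: (@measurable_fun_to_trace _ I1 _ _ (eps n)); last exact: eps_I1.
have me : measurable_fun setT eE.
  by apply: (@measurable_fun_to_trace _ I1 _ _ e).
have iid : iid_innovations Z P eE by exact: independent_seq_trace.
(* The points of [E] are all reals. The value [0] outside [I1] makes differentiability, continuity
   and vanishing at [theta] hold at every point. *)
pose q (t : R) (x : E) : R :=
  if x \in I1 then phi_inv I1 phi t (phi theta x) - x else 0.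
pose dq (t : R) (x : E) : R :=
  if x \in I1 then dphi_inv Theta I1 phi t (phi theta x) else 0.
have mq t : a <= t <= b -> measurable_fun setT (q t).
  move=> tab; have [bij_t inc_t] := h_bij t (inTheta t tab).
  (* Only values on [I1] matter here, and there [q t] is a difference of two nondecreasing
     functions. *)
  apply: (@trace_measurable_ext _ I1
    (fun x => phi_inv I1 phi t (phi theta x) - x)).
    by move=> x xI; rewrite /q xI.
  apply: measurable_funB; apply: trace_nondecreasing_measurable => //.
  exact: phi_inv_nondecreasing bij_th bij_t inc_th inc_t.
have dqP x t : a <= t <= b ->
    diff_quot (q ^~ x) t @ within Theta t^' --> dq t x.
  move=> tab; rewrite /dq; case: ifPn => xI.
    have -> : diff_quot (q ^~ x) t =
        diff_quot (fun t => phi_inv I1 phi t (phi theta x)) t.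
      by apply/funext => s; rewrite /diff_quot /q xI opprB addrA subrK.
    apply: derivable_on_cvg; have [+ _] := h_C1 _ (fun_th x (set_mem xI)).
    by apply; exact: inTheta.
  have -> : diff_quot (q ^~ x) t = cst 0.
    by apply/funext => s; rewrite /diff_quot /q (negbTE xI) subrr mul0r.
  exact: cvg_cst.
have cdq x : {within `[a, b], continuous (dq ^~ x)}.
  have [xI|xI] := boolP (x \in I1).
    have -> : dq ^~ x = fun t => dphi_inv Theta I1 phi t (phi theta x).
      by apply/funext => t; rewrite /dq xI.
    apply: (continuous_subspaceW ab_Theta).
    by have [_] := h_C1 _ (fun_th x (set_mem xI)).
  have -> : dq ^~ x = cst 0 by apply/funext => t; rewrite /dq (negbTE xI).
  by apply: continuous_subspaceT => t; exact: cvg_cst.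
have q_theta x : q theta x = 0.
  by rewrite /q; case: ifPn => // /set_mem xI; rewrite (phi_invK bij_th)// subrr.
have supE : expect_sup P `[a, b] (fun t w => `|dpsi t w| ^+ 4) =
    (\int[P]_w ereal_sup [set (`|dq t (eE w)| ^+ 4)%:E | t in `[a, b]])%E.
  rewrite /expect_sup; apply: eq_integral => w _; congr ereal_sup.
  apply: eq_imagel => t _.
  by rewrite /dq /dpsi /eE mem_set//; exact: e_I1.
have S4_int :
    (\int[P]_w ereal_sup [set (`|dq t (eE w)| ^+ 4)%:E | t in `[a, b]] < +oo)%E.
  by rewrite -supE; apply: h_L4 => //; exact: segment_compact.
have ME t : a <= t <= b ->
    M t = fine (\int[P]_w ((`|q t (eE w)| ^+ 2)%R)%:E)%E.
  move=> tab; rewrite /M /contrast unlock; congr fine.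
  by apply: eq_integral => w _; rewrite /q /eE mem_set//; exact: e_I1.
have M_sep t : a <= t <= b -> t != theta ->
    0 < (t - theta) * derive_on Theta M t.
  by move=> tab tt; apply: h_sep => //; rewrite in_itv.
pose H (t : R) (x : E) := 2 * dq (clip a b t) x * q (clip a b t) x.
(* The iterates stay in [[a, b]], so the clipping inside [H] is the identity along the path; the
   minus sign of [T_n] is absorbed by [q], which is the inverse minus the innovation. *)
have hatE n w : theta_hat n w = prm Z a b theta0 H n w.
  elim: n w => [//|n IH] w /=.
  rewrite {1}/theta_hat /= -/(theta_hat n w) IH; congr clip.
  have tab : a <= prm Z a b theta0 H n w <= b by apply: prm_itv => //; exact: th_cc.
  rewrite /H (clip_id tab) /q /dq /Z mem_set// /gamma /X; congr (_ - _).
  by rewrite div1r; ring.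
split.
  apply: cvg_in_distribution_dirac.
    move=> n; apply: measurable_funM => //; apply: measurable_funB => //.
    rewrite (_ : theta_hat n = prm Z a b theta0 H n); last by apply/funext => w; exact: hatE.
    exact: (measurable_quadratic_contrast_prm ab th_oo ab_Theta mq dqP cdq
      theta0 mZ n).
  move=> eta eta0.
  (* Squaring turns the normalisation [sqrt n] into the factor [n] of the localised estimate. *)
  rewrite (_ : (fun n => _) = fun n => fine (P [set w | eta <
      n%:R * (prm Z a b theta0 H n w - theta) ^+ 2])); last first.
    apply/funext => n; congr (fine (P _)); apply/funext => w /=.
    by rewrite exprMn sqr_sqrtr ?ler0n// hatE.
  exact: (quadratic_contrast_prm_probability me ab th_oo ab_Theta mq dqP cdq
    q_theta S4_int ME M_sep mZ iid th0 h_M2 eta0).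
move=> hM2 n; rewrite unlock.
have M2 t : a <= t <= b -> 1 / 2 <= derive_on Theta (derive_on Theta M) t.
  by move=> tab; apply: hM2; rewrite in_itv.
under eq_integral do rewrite hatE.
rewrite /C1 supE.
exact: (quadratic_contrast_prm_rate me ab th_oo ab_Theta mq dqP cdq
  q_theta S4_int ME M_sep mZ iid th0 M2 n).
Qed.
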